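(* Let $n,k$ be integers with $1\le k\le n-1$, and let $\mathcal{T}^{(n,k)}$ be the class of all trees with boundary having $n$ vertices in total, of which exactly $k$ are interior. A tree $G\in\mathcal{T}^{(n,k)}$ has the Faber-Krahn property in $\mathcal{T}^{(n,k)}$ if and only if $G$ is a comet, i.e. $G$ consists of a path $v_1v_2\cdots v_k$ of interior vertices, where $v_1$ is adjacent to exactly one boundary vertex (if $k\ge 2$), and $v_k$ is adjacent to all remaining boundary vertices (for $k=1$, $G$ is the star with $n-1$ leaves). Such a $G$ is uniquely determined up to isomorphism.
   Context: A tree with boundary is a finite tree $G=(V,E)$ whose vertex set is partitioned into the set $\partial V$ of boundary vertices, which are exactly the vertices of degree $1$, and the set $V_0$ of interior vertices, which are exactly the vertices of degree at least $2$; both sets are assumed nonempty. The discrete Dirichlet operator is $\Delta_0=D_0-A_0$, the $|V_0|\times|V_0|$ matrix obtained from the graph Laplacian $D-A$ of $G$ (with $D$ the diagonal matrix of vertex degrees in $G$ and $A$ the adjacency matrix) by deleting the rows and columns of boundary vertices. The first Dirichlet eigenvalue $\lambda(G)$ is the smallest eigenvalue of $\Delta_0$. A graph $G$ in a class $\mathcal{C}$ has the Faber-Krahn property in $\mathcal{C}$ if $\lambda(G)\le\lambda(H)$ for all $H\in\mathcal{C}$. *)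

(* Defs.v *)
From HB Require Import structures.
From mathcomp Require Import all_boot all_order all_algebra.
From mathcomp Require Import reals.
Set Implicit Arguments.
Unset Strict Implicit.
Unset Printing Implicit Defensive.
Import Order.TTheory GRing.Theory Num.Theory.

Section Graph.
Variables (n : nat) (e : rel 'I_n).

Definition deg (v : 'I_n) : nat := #|[set w | e v w]|.

Definition boundary : {set 'I_n} := [set v | deg v == 1%N].
Definition interior : {set 'I_n} := [set v | 2 <= deg v].

Definition simple_graph : Prop := symmetric e /\ irreflexive e.
Definition connected_graph : Prop := forall x y : 'I_n, connect e x y.
Definition acyclic : Prop :=
  forall (x : 'I_n) (p : seq 'I_n),
    uniq (x :: p) -> (2 <= size p)%N -> path e x p -> ~~ e (last x p) x.
Definition is_tree : Prop := [/\ simple_graph, connected_graph & acyclic].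

Definition tree_with_boundary : Prop :=
  [/\ is_tree, (forall v, 1 <= deg v)%N, boundary != set0 & interior != set0].

Definition dirichlet_op (R : nzRingType) : 'M[R]_#|interior| :=
  (\matrix_(i, j) ((deg (enum_val i))%:R *+ (i == j)
                   - (e (enum_val i) (enum_val j))%:R))%R.

Definition first_dirichlet_eigenvalue (R : realType) (lam : R) : Prop :=
  eigenvalue (dirichlet_op R) lam /\
  forall mu : R, eigenvalue (dirichlet_op R) mu -> (lam <= mu)%R.

End Graph.

Definition in_class_T (n k : nat) (e : rel 'I_n) : Prop :=
  tree_with_boundary e /\ #|interior e| = k.

Definition faber_krahn (R : realType) (n k : nat) (G : rel 'I_n) : Prop :=
  forall H : rel 'I_n, in_class_T k H ->
    forall lG lH : R, first_dirichlet_eigenvalue G lG ->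
      first_dirichlet_eigenvalue H lH -> (lG <= lH)%R.

(* Comet: a path v_1 ... v_k of interior vertices (v : 'I_k -> 'I_n,
   v_1 = v 0, v_k = v (k-1)), consecutive ones adjacent; if k >= 2 then v_1
   is adjacent to exactly one boundary vertex; every other boundary vertex
   is adjacent to v_k (for k = 1 this says G is a star). *)
Definition comet (n k : nat) (G : rel 'I_n) : Prop :=
  exists (v : nat -> 'I_n),
    [/\ {in gtn k &, injective v},
        (forall i, (i < k)%N -> v i \in interior G),
        (forall i, (i.+1 < k)%N -> G (v i) (v i.+1)),
        ((2 <= k)%N -> #|[set b in boundary G | G (v 0%N) b]| = 1%N) &
        (forall b, b \in boundary G -> G (v 0%N) b || G (v k.-1) b)].

Definition graph_iso (n : nat) (G H : rel 'I_n) : Prop :=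
  exists f : 'I_n -> 'I_n, bijective f /\ forall x y, G x y = H (f x) (f y).

(* Main.v *)
Require Import Defs.
From HB Require Import structures.
From mathcomp Require Import all_boot all_order all_algebra.
From mathcomp Require Import reals.
From mathcomp Require Import ring lra zify.
Set Implicit Arguments.
Unset Strict Implicit.
Unset Printing Implicit Defensive.
Import Order.TTheory GRing.Theory Num.Theory.
Local Open Scope ring_scope.

(** Let [f] be a positive first eigenfunction of a tree [G], extended by [0] to the
    boundary, with minimum [a] at the interior vertex [x] and maximum at [z]. As
    [lambda > 0], [x] has a leaf neighbour, so some leaf-to-leaf path starts at that
    leaf, visits [x] and then [z]. Every other leaf edge carries energy at least [a^2];
    and the values of [f] off the path all lie between [a] and [f z], so that they can
    be inserted into the walk of values along the path, after [x], without increasing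
    its energy. The resulting walk is a function on the comet, with [x] as the vertex
    that carries the bunch of leaves: it has the same norm as [f] and at most its energy.
    Hence the comet minimises the Rayleigh quotient.

    If the eigenvalues agree, the walk is an eigenfunction of the comet. An interior
    vertex off the path must have value [a]; placing it next to [x] yields two equal
    minimal values at the end of a sequence which is strictly concave there, a
    contradiction. So the path contains all interior vertices, and comparing the
    eigenvalue equations at [x] shows that all leaves but one are attached to [x]. *)

(** * Smallest eigenvalue of a symmetric real matrix *)

Section SymmetricMatrix.
Variables (R : realType) (N : nat).
Implicit Types (A B : 'M[R]_N) (u v w : 'rV[R]_N).

Definition bform B u w : R := (u *m B *m w^T) 0 0.
Definition sqnorm u : R := \sum_i u 0 i ^+ 2.

Lemma bformE B u w : bform B u w = \sum_i \sum_j u 0 i * B i j * w 0 j.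
Proof.
rewrite /bform mxE exchange_big /=; apply: eq_bigr => j _.
by rewrite !mxE mulr_suml.
Qed.

Lemma bform1 u : bform 1%:M u u = sqnorm u.
Proof.
by rewrite /bform mulmx1 mxE; apply: eq_bigr => i _; rewrite mxE expr2.
Qed.

Lemma sqnorm_ge0 u : 0 <= sqnorm u.
Proof. by apply: sumr_ge0 => i _; apply: sqr_ge0. Qed.

Lemma sqnorm_eq0 u : (sqnorm u == 0) = (u == 0).
Proof.
apply/eqP/eqP => [h|->]; last by apply: big1 => i _; rewrite mxE expr0n.
apply/rowP => i; rewrite mxE; apply/eqP; rewrite -sqrf_eq0.
by move/psumr_eq0P: h => -> // j _; apply: sqr_ge0.
Qed.

(** A product of two coordinates is at most [sqnorm u] in absolute value; the summand 1 keeps the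
    constant positive. *)
Lemma bform_bounded B : exists2 c : R, 0 < c & forall u, `|bform B u u| <= c * sqnorm u.
Proof.
exists (1 + \sum_i \sum_j `|B i j|).
  by rewrite ltr_pwDl // sumr_ge0 // => i _; apply: sumr_ge0.
move=> u; rewrite bformE mulrDl mul1r.
apply: le_trans (_ : (\sum_i \sum_j `|B i j|) * sqnorm u <= _); last first.
  by rewrite lerDr sqnorm_ge0.
rewrite mulr_suml (le_trans (ler_norm_sum _ _ _)) // ler_sum // => i _.
rewrite mulr_suml (le_trans (ler_norm_sum _ _ _)) // ler_sum // => j _.
rewrite -mulrA mulrCA normrM ler_wpM2l //.
have le1 l : u 0 l ^+ 2 <= sqnorm u.
  by rewrite /sqnorm (bigD1 l) //= lerDl sumr_ge0 // => m _; apply: sqr_ge0.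
rewrite ler_norml; move: (le1 i) (le1 j) (sqr_ge0 (u 0 i + u 0 j)) (sqr_ge0 (u 0 i - u 0 j)).
move: (u 0 i) (u 0 j) (sqnorm u) => a b c h1 h2; rewrite !expr2 in h1 h2 * => h3 h4.
by apply/andP; split; lra.
Qed.

Lemma bform_combo B u w (t : R) : B^T = B ->
  bform B (u - t *: w) (u - t *: w) =
  bform B u u - 2 * t * bform B u w + t ^+ 2 * bform B w w.
Proof.
move=> symB.
have sym : bform B w u = bform B u w.
  by rewrite /bform -[in LHS]mulmxA -[w *m _]trmxK mxE trmx_mul trmx_mul trmxK symB.
have -> : bform B (u - t *: w) (u - t *: w) =
    bform B u u - t * bform B u w - t * bform B w u + t ^+ 2 * bform B w w.
  rewrite /bform [(_ - _)^T]linearB /= [(t *: w)^T]linearZ /= mulmxBl mulmxBr !mulmxBl.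
  rewrite -!scalemxAl -!scalemxAr; rewrite !mxE; ring.
rewrite sym; ring.
Qed.

Definition psd B := forall u, 0 <= bform B u u.

(** Positivity at [u - t *: (u *m B)], with [t] the inverse of a bound on the form, gives
    [0 <= - t * sqnorm (u *m B)]. *)
Lemma psd_kernel B u : B^T = B -> psd B -> bform B u u = 0 -> u *m B = 0.
Proof.
move=> symB pB u0; apply/eqP; rewrite -sqnorm_eq0.
have [c c0 hc] := bform_bounded B.
have E : bform B u (u *m B) = sqnorm (u *m B).
  by rewrite -bform1 /bform mulmx1.
have := pB (u - c^-1 *: (u *m B)); rewrite bform_combo // u0 E.
have := le_trans (ler_norm _) (hc (u *m B)).
have := sqnorm_ge0 (u *m B); move: (sqnorm _) (bform _ _ _) => s b s0 bs.
move=> h; rewrite eq_le s0 andbT.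
have ci : 0 < c^-1 by rewrite invr_gt0.
have : c^-1 ^+ 2 * b <= c^-1 * s.
  rewrite expr2 -mulrA ler_pM2l // ler_pdivrMl //.
nra.
Qed.

(** Positivity is tested at [u - c^-1 *: (u *m invmx B)], where [c] bounds the form of the inverse;
    then [d = c^-1] works. *)
Lemma psd_unit_coercive B : B^T = B -> psd B -> B \in unitmx ->
  exists2 d : R, 0 < d & forall u, d * sqnorm u <= bform B u u.
Proof.
move=> symB pB uB.
have [c c0 hc] := bform_bounded (invmx B).
exists c^-1; first by rewrite invr_gt0.
move=> u; pose w := u *m invmx B.
have symI : (invmx B)^T = invmx B by rewrite trmx_inv symB.
have E1 : bform B u w = sqnorm u.
  by rewrite -bform1 /bform mulmx1 trmx_mul symI mulmxA -(mulmxA u) mulmxV // mulmx1.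
have E2 : bform B w w = bform (invmx B) u u.
  by rewrite /bform trmx_mul symI mulmxKV // mulmxA.
have := pB (u - c^-1 *: w); rewrite bform_combo // E1 E2.
have := le_trans (ler_norm _) (hc u).
have := sqnorm_ge0 u; move: (sqnorm _) (bform _ _ _) (bform _ _ _) => s b b' s0 bs h.
have ci : 0 < c^-1 by rewrite invr_gt0.
have : c^-1 ^+ 2 * b' <= c^-1 * s.
  by rewrite expr2 -mulrA ler_pM2l // ler_pdivrMl.
lra.
Qed.

Lemma bform_shift A lam u : bform (A - lam%:M) u u = bform A u u - lam * sqnorm u.
Proof.
rewrite -bform1 /bform mulmxBr mulmxBl mul_mx_scalar -scalemxAl mulmx1.
by rewrite !mxE.
Qed.

Lemma symmetric_shift A lam : A^T = A -> (A - lam%:M)^T = A - lam%:M.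
Proof. by move=> h; rewrite linearB /= h tr_scalar_mx. Qed.

(** The eigenvalue is the supremum of the lower bounds [S] of the Rayleigh quotient: were
    [A - (sup S)%:M] invertible, coercivity would push the supremum up. *)
Lemma symmetric_min_eigenvalue A : (0 < N)%N -> A^T = A ->
  exists2 lam, eigenvalue A lam & psd (A - lam%:M).
Proof.
move=> N0 symA; have [c c0 hc] := bform_bounded A.
pose S (t : R) := forall u, t * sqnorm u <= bform A u u.
have S0 : S (- c).
  move=> u; rewrite mulNr lerNl; apply: le_trans (hc u).
  by rewrite -normrN ler_norm.
(* Any nonzero vector bounds [S] from above; [0 < N] provides one. *)
pose u0 : 'rV[R]_N := const_mx 1.
have u0n : 0 < sqnorm u0.
  rewrite lt_neqAle sqnorm_ge0 andbT eq_sym sqnorm_eq0.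
  by apply/eqP => /rowP /(_ (Ordinal N0)); rewrite !mxE => /eqP; rewrite oner_eq0.
have hS : classical_sets.has_ubound S.
  exists (bform A u0 u0 / sqnorm u0) => t /(_ u0).
  by rewrite ler_pdivlMr.
have pB : psd (A - (sup S)%:M).
  move=> u; rewrite bform_shift subr_ge0.
  have [->|nz] := eqVneq u 0.
    have -> : sqnorm 0 = 0 by apply/eqP; rewrite sqnorm_eq0.
    by rewrite mulr0 /bform !mul0mx mxE.
  have un : 0 < sqnorm u by rewrite lt_neqAle sqnorm_ge0 andbT eq_sym sqnorm_eq0.
  rewrite -ler_pdivlMr //; apply: ge_sup; first by exists (- c).
  by move=> t /(_ u); rewrite ler_pdivlMr.
exists (sup S) => //.
rewrite /eigenvalue /eigenspace kermx_eq0 row_free_unit.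
apply/negP => uB.
have [d d0 hd] := psd_unit_coercive (symmetric_shift _ symA) pB uB.
have : S (sup S + d).
  by move=> u; move: (hd u); rewrite bform_shift mulrDl; lra.
by move/(ub_le_sup (hS)); lra.
Qed.

Lemma psd_eigenvalue_min A lam mu : psd (A - lam%:M) -> eigenvalue A mu -> lam <= mu.
Proof.
move=> p0 /eigenvalueP [v vA vn].
have := p0 v; rewrite bform_shift.
have -> : bform A v v = mu * sqnorm v by rewrite -bform1 /bform vA -scalemxAl mulmx1 mxE.
rewrite -mulrBl pmulr_lge0 ?subr_ge0 //.
by rewrite lt_neqAle sqnorm_ge0 andbT eq_sym sqnorm_eq0.
Qed.

(** Passes from the definition of the first eigenvalue to its variational form. *)
Lemma min_eigenvalue_psd A lam : A^T = A -> eigenvalue A lam ->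
  (forall mu, eigenvalue A mu -> lam <= mu) -> psd (A - lam%:M).
Proof.
move=> symA elam min.
have N0 : (0 < N)%N.
  case/eigenvalueP: elam => v _; apply: contraNltn; rewrite leqn0 => /eqP N0.
  by apply/eqP/rowP => i; have := ltn_ord i; rewrite {2}N0.
have [l0 e0 p0] := symmetric_min_eigenvalue N0 symA.
suff <- : l0 = lam by [].
by apply/eqP; rewrite eq_le min // andbT (psd_eigenvalue_min p0 elam).
Qed.

End SymmetricMatrix.

(** * Dirichlet eigenfunctions *)

Section Dirichlet.
Variables (R : realType) (n : nat) (e : rel 'I_n).
Implicit Types (f g : 'I_n -> R) (x y : 'I_n).

(** The Laplacian of the whole graph; extension by zero ([dirichlet_fun]) replaces the deletion of
    boundary rows and columns. *)
Definition lap f x : R := \sum_y (f x - f y) *+ e x y.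
Definition energy f : R := \sum_x f x * lap f x.
Definition sqsum f : R := \sum_x f x ^+ 2.
Definition edge_energy f x y : R := (f x - f y) ^+ 2 *+ e x y.
Definition dirichlet_fun f := forall x, x \notin interior e -> f x = 0.
Definition eigenfun lam f := forall x, x \in interior e -> lap f x = lam * f x.

Lemma lapE f x : lap f x = f x *+ deg e x - \sum_y f y *+ e x y.
Proof.
rewrite /lap; under eq_bigr do rewrite mulrnBl.
rewrite sumrB; congr (_ - _).
rewrite /deg -sumr_const [RHS]big_mkcond /=.
by apply: eq_bigr => y _; rewrite inE; case: (e x y).
Qed.

Lemma energy_edges f : symmetric e ->
  2 * energy f = \sum_x \sum_y edge_energy f x y.
Proof.
move=> syme.
have E : energy f = \sum_x \sum_y (f x * (f x - f y)) *+ e x y.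
  apply: eq_bigr => x _; rewrite mulr_sumr.
  by apply: eq_bigr => y _; rewrite mulrnAr.
have E' : energy f = \sum_x \sum_y (f y * (f y - f x)) *+ e x y.
  rewrite E exchange_big /=; apply: eq_bigr => x _.
  by apply: eq_bigr => y _; rewrite syme.
rewrite mulr_natl mulr2n {1}E E' -big_split /=; apply: eq_bigr => x _.
rewrite -big_split /=; apply: eq_bigr => y _.
by rewrite -mulrnDl /edge_energy; congr (_ *+ _); ring.
Qed.

Lemma edge_energy_ge0 f x y : 0 <= edge_energy f x y.
Proof. by rewrite mulrn_wge0 // sqr_ge0. Qed.

Lemma energy_ge0 f : symmetric e -> 0 <= energy f.
Proof.
move=> syme; rewrite -(pmulr_rge0 _ (ltr0n R 2)) energy_edges //.
by do 2![apply: sumr_ge0 => ? _]; apply: edge_energy_ge0.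
Qed.

Lemma sqsum_gt0 f : (exists x, f x != 0) -> 0 < sqsum f.
Proof.
case=> x fx; rewrite /sqsum (bigD1 x) //=.
by rewrite ltr_pwDl ?exprn_even_gt0 // sumr_ge0 // => y _; apply: sqr_ge0.
Qed.

Lemma dirichlet_op_sym : symmetric e -> (dirichlet_op e R)^T = dirichlet_op e R.
Proof.
move=> syme; apply/matrixP => i j; rewrite !mxE syme eq_sym.
by case: eqP => [->|].
Qed.

Definition interior_vec f : 'rV[R]_#|interior e| := \row_i f (enum_val i).

Lemma sum_interior (F : 'I_n -> R) : (forall x, x \notin interior e -> F x = 0) ->
  \sum_(i < #|interior e|) F (enum_val i) = \sum_x F x.
Proof.
move=> F0; rewrite -big_enum_val [RHS](bigID (mem (interior e))) /=.
by rewrite [X in _ + X]big1 ?addr0.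
Qed.

Lemma mul_interior_vec f : symmetric e -> dirichlet_fun f ->
  interior_vec f *m dirichlet_op e R = interior_vec (lap f).
Proof.
move=> syme f0; apply/rowP => j; rewrite !mxE lapE.
under eq_bigr do rewrite !mxE mulrBr.
rewrite sumrB; congr (_ - _).
  rewrite (bigD1 j) //= eqxx mulr1n mulr_natr big1 ?addr0 // => i /negPf ->.
  by rewrite mulr0n mulr0.
rewrite -[RHS]sum_interior => [|x /f0 ->]; last by rewrite mul0rn.
by apply: eq_bigr => i _; rewrite mulr_natr syme.
Qed.

Lemma bform_interior_vec f : symmetric e -> dirichlet_fun f ->
  bform (dirichlet_op e R) (interior_vec f) (interior_vec f) = energy f.
Proof.
move=> syme f0; rewrite /bform mul_interior_vec // mxE.
rewrite /energy -sum_interior => [|x /f0 ->]; last by rewrite mul0r.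
by apply: eq_bigr => i _; rewrite !mxE mulrC.
Qed.

Lemma sqnorm_interior_vec f : dirichlet_fun f -> sqnorm (interior_vec f) = sqsum f.
Proof.
move=> f0; rewrite /sqsum -sum_interior => [|x /f0 ->]; last by rewrite expr0n.
by apply: eq_bigr => i _; rewrite !mxE.
Qed.

Lemma interior_vec_surj u : exists2 f, dirichlet_fun f & interior_vec f = u.
Proof.
exists (fun x => \sum_i u 0 i *+ (enum_val i == x)).
  move=> x xi; apply: big1 => i _; case: eqP => // E.
  by case/negP: xi; rewrite -E enum_valP.
apply/rowP => j; rewrite mxE (bigD1 j) //= eqxx mulr1n big1 ?addr0 // => i ij.
by rewrite (inj_eq enum_val_inj) (negPf ij).
Qed.

Lemma interior_vec_eigen lam f :
  interior_vec (lap f) = lam *: interior_vec f <-> eigenfun lam f.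
Proof.
split=> [h x xi|h]; last by apply/rowP => i; rewrite !mxE h // enum_valP.
by move/rowP/(_ (enum_rank_in xi x)): h; rewrite !mxE enum_rankK_in.
Qed.

Lemma first_dirichlet_exists : symmetric e -> interior e != set0 ->
  exists lam : R, first_dirichlet_eigenvalue e lam.
Proof.
move=> syme ie; rewrite -card_gt0 in ie.
have [lam el pl] := symmetric_min_eigenvalue ie (dirichlet_op_sym syme).
by exists lam; split=> // mu; apply: psd_eigenvalue_min.
Qed.

Section FirstEigenvalue.
Variable lam : R.
Hypotheses (syme : symmetric e) (fst_lam : first_dirichlet_eigenvalue e lam).

Lemma rayleigh f : dirichlet_fun f -> lam * sqsum f <= energy f.
Proof.
move=> f0; have [el ml] := fst_lam.
have := min_eigenvalue_psd (dirichlet_op_sym syme) el ml (interior_vec f).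
by rewrite bform_shift bform_interior_vec // sqnorm_interior_vec // subr_ge0.
Qed.

(** A minimiser of the Rayleigh quotient is a zero of the semidefinite form of the shifted operator,
    hence in its kernel. *)
Lemma rayleigh_eq f : dirichlet_fun f -> energy f <= lam * sqsum f -> eigenfun lam f.
Proof.
move=> f0 le; have [el ml] := fst_lam.
have pB := min_eigenvalue_psd (dirichlet_op_sym syme) el ml.
have := psd_kernel (symmetric_shift lam (dirichlet_op_sym syme)) pB (u := interior_vec f).
rewrite bform_shift bform_interior_vec // sqnorm_interior_vec //.
have -> : energy f = lam * sqsum f by apply/eqP; rewrite eq_le le rayleigh.
move/(_ (subrr _)); rewrite mulmxBr mul_interior_vec // mul_mx_scalar.
by move/eqP; rewrite subr_eq0 => /eqP /interior_vec_eigen.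
Qed.

Lemma first_eigenfun_exists :
  exists f, [/\ dirichlet_fun f, exists x, f x != 0 & eigenfun lam f].
Proof.
have [/eigenvalueP[v vA vn] _] := fst_lam; have [f f0 fv] := interior_vec_surj v.
exists f; split=> //.
  apply/existsP; apply: contraR vn; rewrite negb_exists => /forallP h.
  by rewrite -fv; apply/eqP/rowP => i; rewrite !mxE; apply/eqP; rewrite -[_ == _]negbK.
by apply/interior_vec_eigen; rewrite -mul_interior_vec // fv.
Qed.

End FirstEigenvalue.

Lemma eigenfun_energy lam f : dirichlet_fun f -> eigenfun lam f ->
  energy f = lam * sqsum f.
Proof.
move=> f0 ef; rewrite /energy /sqsum mulr_sumr; apply: eq_bigr => x _.
have [xi|/f0 ->] := boolP (x \in interior e); last by rewrite expr0n mul0r mulr0.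
by rewrite ef // expr2 mulrCA.
Qed.

End Dirichlet.

(** * Leaves, connectedness and positivity of the first eigenfunction *)

Section TreeBasics.
Variables (n : nat) (e : rel 'I_n).
Hypothesis twb : tree_with_boundary e.
Implicit Types (x y b : 'I_n).

Lemma twb_sym : symmetric e. Proof. by case: twb => [[[]]]. Qed.
Lemma twb_irr : irreflexive e. Proof. by case: twb => [[[]]]. Qed.
Lemma twb_acyclic : acyclic e. Proof. by case: twb => [[]]. Qed.

Lemma notin_interior x : (x \notin interior e) = (x \in boundary e).
Proof. by case: twb => _ /(_ x) d1 _ _; rewrite !inE; move: d1; case: (deg e x) => [|[|]]. Qed.

Lemma boundary_notin_interior x : x \in boundary e -> (x \in interior e) = false.
Proof. by rewrite -notin_interior => /negPf. Qed.

Lemma boundary_setC : boundary e = ~: interior e.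
Proof. by apply/setP => x; rewrite in_setC notin_interior. Qed.

Lemma connected_closed (a : pred 'I_n) :
  (forall x y, e x y -> a x -> a y) -> forall x y, a x -> a y.
Proof.
move=> ha x y; have [[_ conn _] _ _ _] := twb.
have E : a x = a y := closed_connect (intro_closed (sym_connect_sym twb_sym) ha) (conn x y).
by rewrite E.
Qed.

Lemma leaf_nbr_unique b x y : b \in boundary e -> e b x -> e b y -> x = y.
Proof.
rewrite inE => /cards1P[z /setP hz] bx byy.
move: (hz x) (hz y); rewrite !inE bx byy => /esym/eqP -> /esym/eqP ->.
by [].
Qed.

(** Two adjacent leaves would form a whole component, leaving no room for an interior vertex. *)
Lemma leaf_nbr_interior b x : b \in boundary e -> e b x -> x \in interior e.
Proof.
move=> bb bx; rewrite -[_ \in _]negbK notin_interior; apply/negP => xb.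
have [_ _ _ /set0Pn[v vi]] := twb.
have : pred2 b x v.
  apply: (connected_closed _ (x := b)); last by rewrite /= eqxx.
  move=> u w uw /= /orP[] /eqP E; rewrite {u}E in uw.
    by rewrite (leaf_nbr_unique bb uw bx) eqxx orbT.
  by rewrite (leaf_nbr_unique xb uw (y := b)) ?eqxx // twb_sym.
by move=> /orP[] /eqP E; rewrite E boundary_notin_interior in vi.
Qed.

Lemma leaf_nbr_exists b : b \in boundary e -> exists x, e b x.
Proof. by rewrite inE => /cards1P[z /setP /(_ z)]; rewrite !inE eqxx; exists z. Qed.

Variables (R : realType) (lam : R).

(** At an interior zero the eigenvalue equation makes the sum of the nonnegative neighbouring values
    vanish, so zeros spread over the tree. *)
Lemma nonneg_eigenfun_pos (f : 'I_n -> R) : dirichlet_fun e f -> eigenfun e lam f ->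
  (forall x, 0 <= f x) -> (exists x, f x != 0) ->
  forall x, x \in interior e -> 0 < f x.
Proof.
move=> f0 ef fge [y fy] x xi; rewrite lt_neqAle fge andbT eq_sym.
apply/negP => /eqP fx.
pose Z u := (u \in interior e) && (f u == 0).
(* A leaf has value 0 in any case, so it counts only if its neighbour is an interior zero; this
   makes [W] closed under adjacency. *)
pose W u := Z u || (u \in boundary e) && [exists z, e u z && Z z].
have : W y.
  apply: (connected_closed _ (x := x)); last by rewrite /W /Z xi fx eqxx.
  move=> u v uv; rewrite /W => /orP[/andP[ui /eqP fu]|/andP[ub /existsP[z /andP[uz Zz]]]].
    have [vi|] := boolP (v \in interior e); last first.
      rewrite notin_interior => vb; apply/orP; right; rewrite vb.
      by apply/existsP; exists u; rewrite twb_sym uv /Z ui fu eqxx.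
    rewrite /Z vi /=; apply/orP; left.
    have := ef u ui; rewrite lapE fu mul0rn mulr0 sub0r => /eqP; rewrite oppr_eq0.
    move/eqP/psumr_eq0P => /(_ (fun i _ => mulrn_wge0 _ (fge i))) /(_ v isT).
    by rewrite uv mulr1n => ->.
  by rewrite (leaf_nbr_unique ub uv uz) Zz.
rewrite /W /Z (negPf fy) andbF /= => /andP[yb _].
by rewrite f0 ?eqxx // notin_interior in fy.
Qed.

(** Taking absolute values keeps the norm and does not raise the energy, so the result is again a
    minimiser, hence an eigenfunction. *)
Lemma first_eigenfun_pos : first_dirichlet_eigenvalue e lam ->
  exists f : 'I_n -> R, [/\ dirichlet_fun e f, forall x, x \in interior e -> 0 < f x &
                            eigenfun e lam f].
Proof.
move=> fl; have [f [f0 fn ef]] := first_eigenfun_exists twb_sym fl.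
pose g x := `|f x|.
have g0 : dirichlet_fun e g by move=> x /f0; rewrite /g => ->; rewrite normr0.
have eg : eigenfun e lam g.
  apply: (rayleigh_eq twb_sym fl) => //.
  have -> : sqsum g = sqsum f by apply: eq_bigr => x _; rewrite real_normK ?num_real.
  rewrite -(eigenfun_energy f0 ef) -(ler_pM2l (ltr0n R 2)) !energy_edges; try exact: twb_sym.
  apply: ler_sum => x _; apply: ler_sum => y _; rewrite /edge_energy /g.
  case: (e x y); rewrite ?mulr0n // !mulr1n -[leRHS]real_normK ?num_real //.
  rewrite -[leLHS]real_normK ?num_real // ler_sqr ?nnegrE //.
  exact: ler_dist_dist.
exists g; split=> //; apply: (nonneg_eigenfun_pos g0 eg) => [x|]; first exact: normr_ge0.
by case: fn => x fx; exists x; rewrite normr_eq0.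
Qed.

(** Otherwise the energy would vanish and [f], constant on the connected graph, would equal its
    value 0 at a leaf. *)
Lemma pos_eigenvalue (f : 'I_n -> R) : dirichlet_fun e f -> eigenfun e lam f ->
  (exists x, f x != 0) -> 0 < lam.
Proof.
move=> f0 ef fn; rewrite ltNge; apply/negP => lam0.
have E0 : energy e f = 0.
  apply/eqP; rewrite eq_le energy_ge0 ?andbT; last exact: twb_sym.
  by rewrite (eigenfun_energy f0 ef) mulr_le0_ge0 // ltW // sqsum_gt0.
have D0 x y : e x y -> f x = f y.
  move=> exy; have := energy_edges f twb_sym; rewrite E0 mulr0 => /esym/psumr_eq0P.
  have ge i j := edge_energy_ge0 e f i j.
  move=> /(_ (fun i _ => sumr_ge0 _ (fun j _ => ge i j))) /(_ x isT) /psumr_eq0P.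
  move=> /(_ (fun j _ => ge x j)) /(_ y isT) /eqP.
  by rewrite /edge_energy exy mulr1n sqrf_eq0 subr_eq0 => /eqP.
case: fn => x /negP[]; have [_ _ /set0Pn[b bb] _] := twb.
pose a u := f u == 0; suff: a x by [].
apply: (connected_closed _ (x := b)); last by rewrite /a f0 // notin_interior.
by move=> u v /D0; rewrite /a => ->.
Qed.

End TreeBasics.

(** * A leaf-to-leaf path through the extreme values of an eigenfunction *)

Section Frame.
Variables (n : nat) (e : rel 'I_n).
Hypothesis twb : tree_with_boundary e.
Let syme := twb_sym twb.

Lemma interior_two_nbrs v a b : e v a -> e v b -> a != b -> v \in interior e.
Proof.
by move=> va vb ab; rewrite inE; apply/card_gt1P; exists a, b; rewrite !inE.
Qed.

Lemma path_inner_interior q c p : path e q (rcons c p) -> uniq (q :: rcons c p) ->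
  {subset c <= interior e}.
Proof.
move=> + + v vc; case/splitPr: vc => c1 c2.
rewrite rcons_cat cat_path => /and3P[_ e1 pc2].
rewrite -cat_cons cat_uniq => /and3P[_ h _].
apply: (interior_two_nbrs (a := last q c1) (b := head p c2)); first by rewrite syme.
  by case: c2 pc2 {h} => [|b c2] /= /andP[].
apply: contraNneq h => E; apply/hasP; exists (head p c2); last by rewrite -E mem_last.
by case: (c2) => [|b s]; rewrite !inE eqxx ?orbT.
Qed.

(** The path grows at its front while its first vertex is interior. A neighbour other than the
    second vertex is new, since otherwise a cycle would close; simple paths have bounded length. *)
Lemma extend_path_to_leaf w l : path e w l -> uniq (w :: l) -> (0 < size l)%N ->
  exists w' l', [/\ path e w' l', uniq (w' :: l'), w' \in boundary e &
                    exists l1, w' :: l' = l1 ++ w :: l].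
Proof.
have [m] := ubnP (n - size l); elim: m w l => // m IHm w l lem pl ul sl.
have [wb|] := boolP (w \in boundary e); first by exists w, l; split=> //; exists nil.
rewrite -(notin_interior twb) negbK => wi.
case: l pl ul sl lem => // h l pl ul _ lem.
have [u wu uh] : exists2 u, e w u & u != h.
  move: wi; rewrite inE => /card_gt1P[a [b []]]; rewrite !inE => wa wb ab.
  by have [E|] := eqVneq a h; [exists b; rewrite // -E eq_sym | exists a].
have uN : u \notin w :: h :: l.
  rewrite !inE (negPf uh) /= negb_or; apply/andP; split.
    by apply: contraTneq wu => ->; rewrite (twb_irr twb).
  apply/negP => ul'; case/splitPr: ul' pl ul {lem} => l1 l2 pl ul.
  have u1 : uniq (w :: h :: rcons l1 u).
    by move: ul; rewrite -cat_rcons -!cat_cons cat_uniq => /and3P[].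
  have p1 : path e w (h :: rcons l1 u).
    by move: pl; rewrite -cat_rcons -cat_cons cat_path => /andP[].
  have := twb_acyclic twb u1 _ p1; rewrite /= size_rcons last_rcons syme wu.
  by move/(_ isT).
have [|||//|w' [l' [p' u' b' [l1 E]]]] := IHm u (w :: h :: l).
- have : (size [:: w, h & l] <= n)%N.
    by rewrite -[leqRHS]card_ord -(card_uniqP ul) max_card.
  by move: lem => /=; lia.
- by rewrite /= syme wu.
- by rewrite cons_uniq uN.
by exists w', l'; split=> //; exists (rcons l1 u); rewrite cat_rcons.
Qed.

Variables (R : realType) (lam : R) (f : 'I_n -> R).
Hypotheses (f0 : dirichlet_fun e f) (fpos : forall x, x \in interior e -> 0 < f x).
Hypotheses (ef : eigenfun e lam f) (lam0 : 0 < lam).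

(** If all neighbours were interior, minimality would make [lap e f x] nonpositive, against
    [0 < lam * f x]. *)
Lemma min_has_leaf x : x \in interior e -> (forall y, y \in interior e -> f x <= f y) ->
  exists2 q, q \in boundary e & e q x.
Proof.
move=> xi xmin; case: (pickP [pred q | (q \in boundary e) && e q x]) => [q /andP[]|h].
  by exists q.
have := mulr_gt0 lam0 (fpos xi); rewrite -ef // ltNge => /negP[].
apply: sumr_le0 => y _; case exy: (e x y); last by rewrite mulr0n.
rewrite mulr1n subr_le0 xmin //; have := h y; rewrite /= syme exy andbT.
by rewrite -(notin_interior twb) => /negbFE.
Qed.

(** A path from [z] to a leaf [q] at [x] is extended beyond [z] to a leaf [p] and read backwards. As
    [q] has a single neighbour, [x] comes right after it. *)
Lemma extremal_path_exists : exists q x t p,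
  [/\ path e q (rcons (x :: t) p), uniq (q :: rcons (x :: t) p),
      q \in boundary e, p \in boundary e & {subset x :: t <= interior e}] /\
  [/\ forall y, y \in interior e -> f x <= f y,
      exists2 z, z \in x :: t & forall y, y \in interior e -> f y <= f z &
      (2 <= #|interior e|)%N -> (0 < size t)%N].
Proof.
have [[_ conn _] _ _ /set0Pn[z0 z0i]] := twb.
have [z zi zmax] : exists2 z, z \in interior e & forall y, y \in interior e -> f y <= f z.
  by case: (@Order.TotalTheory.arg_maxP _ _ _ z0 (mem (interior e)) f z0i) => z zi h; exists z.
(* Minimising over the interior without [z] separates [x] from [z] even if [f] is constant there;
   the minimum stays global because [f z] is the maximum. *)
have [x xi [xmin xz]] : exists2 x, x \in interior e &
    (forall y, y \in interior e -> f x <= f y) /\ ((2 <= #|interior e|)%N -> x != z).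
  have [E|/set0Pn[x0 x0i]] := eqVneq (interior e :\ z) set0.
    exists z => //; split=> [y yi|]; last by rewrite (cardsD1 z) zi E cards0.
    suff -> : y = z by [].
    by apply/eqP; apply: contraTT yi => yz; have := in_setD1 y (interior e) z;
      rewrite E inE yz /= => <-.
  case: (@Order.TotalTheory.arg_minP _ _ _ x0 (mem (interior e :\ z)) f x0i).
  move=> x /setD1P[xz xi] h; exists x => //; split=> // y yi.
  have [->|yz] := eqVneq y z; first exact: zmax.
  by apply: h; apply/setD1P.
have [q qb qx] := min_has_leaf xi xmin.
have [l0 pl0 ql0] := connectP (conn z q).
case/shortenP: pl0 ql0 => l pl ul _ ql.
have zq : z != q by apply: contraTneq zi => ->; rewrite (notin_interior twb).
have sl : (0 < size l)%N by case: l ql {pl ul} => //= E; rewrite E eqxx in zq.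
have [p [l' [pl' ul' pb [l1 El]]]] := extend_path_to_leaf pl ul sl.
have lastl' : last p l' = q.
  by rewrite -[LHS](last_cons z) El last_cat /= ql.
have sl' : (0 < size l')%N.
  by have := congr1 size El; rewrite size_cat /= !addnS => -[->]; apply: ltn_addl.
case: l' pl' ul' lastl' El sl' => // h l' pl' ul' /= lastl' El _.
have pc : path e q (rcons (rev (belast h l')) p).
  rewrite -lastl' -rev_cons -[_ :: belast _ _]/(belast p (h :: l')).
  rewrite -[last h l']/(last p (h :: l')) rev_path.
  by rewrite (eq_path (e' := e)) // => a b /=; rewrite syme.
have uc : uniq (q :: rcons (rev (belast h l')) p).
  rewrite -rev_cons -rev_rcons rev_uniq rcons_cons -lastl' -lastI.
  by [].
have zc : z \in rev (belast h l').
  have : z \in p :: h :: l' by rewrite El mem_cat inE eqxx orbT.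
  rewrite lastI /= lastl' inE mem_rcons inE (negPf zq) mem_rev /=.
  by case: eqP => // E; rewrite E (boundary_notin_interior twb) in zi.
case E: (rev _) pc uc zc => [//|x' t] pc uc zc.
have E' : x' = x.
  by move: pc => /= /andP[qx' _]; apply: (leaf_nbr_unique qb).
rewrite {x'}E' in E pc uc zc.
exists q, x, t, p; split; split=> //; first exact: path_inner_interior pc uc.
  by exists z.
by move=> /xz xz'; move: zc; rewrite inE eq_sym (negPf xz') /=; case: (t).
Qed.

End Frame.

(** * Energy of walks *)

Section Chain.
Variable R : realType.
Implicit Types (a v m : R) (s t : seq R).

(** The energy of a function on a path whose successive values are [a :: s]. *)
Fixpoint chain a s : R := if s is b :: s' then (a - b) ^+ 2 + chain b s' else 0.

(* A walk that starts at [a] and reaches [m] crosses every level [v] in between;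
   subdividing the crossing step at [v] does not increase the energy. *)
Lemma chain_insert a t v m : m \in a :: t -> a <= v <= m ->
  exists2 t', perm_eq t' (v :: t) & chain a (rcons t' 0) <= chain a (rcons t 0).
Proof.
elim: t a => [|b t IHt] a.
  rewrite inE => /eqP -> /andP[h1 h2]; have -> : v = a by apply/eqP; rewrite eq_le h1 h2.
  by exists [:: a] => //=; rewrite subrr expr0n add0r.
(* If [v <= b], the first step already crosses the level [v]. Otherwise either [m = a], which forces
   [v = a], or [m] is still ahead and the induction continues from [b]. *)
move=> mt /andP[av vm]; have [vb|bv] := lerP v b.
  exists (v :: b :: t) => //=; rewrite addrA lerD2r; nra.
have [E|ne] := eqVneq m a.
  exists (v :: b :: t) => //=.
  have -> : v = a by apply/eqP; rewrite eq_le av -E vm.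
  by rewrite subrr expr0n add0r.
have mbt : m \in b :: t by move: mt; rewrite in_cons (negPf ne).
have [|t' pt' ct'] := IHt b mbt; first by rewrite (ltW bv).
exists (b :: t'); last by rewrite /= lerD2l.
by rewrite -[v :: b :: t]/([:: v] ++ b :: t) perm_sym perm_catC /= perm_cons
  perm_sym (perm_trans pt') // perm_sym perm_catC.
Qed.

Lemma chain_insert_seq a t vs m : m \in a :: t -> all (fun v => a <= v <= m) vs ->
  exists2 t', perm_eq t' (vs ++ t) & chain a (rcons t' 0) <= chain a (rcons t 0).
Proof.
move=> mt; elim: vs => [_|v vs IH /= /andP[hv /IH[t1 p1 c1]]]; first by exists t.
have m1 : m \in a :: t1.
  move: mt; rewrite !in_cons (perm_mem p1) mem_cat.
  by case/orP => ->; rewrite ?orbT.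
have [t' p' c'] := chain_insert m1 hv.
exists t'; last exact: le_trans c1.
by rewrite (perm_trans p') // perm_cons.
Qed.

End Chain.

(** * Sums over unordered pairs *)

Section HalfSum.
Variables (R : realType) (T : eqType) (D : T -> T -> R).
Hypotheses (symD : forall u v, D u v = D v u) (D0 : forall u, D u u = 0).
Hypothesis D_ge0 : forall u v, 0 <= D u v.

(** Each unordered pair of positions counts once, so cutting a vertex list into blocks cuts the
    energy accordingly. *)
Fixpoint half_sum (l : seq T) : R :=
  if l is v :: l' then \sum_(u <- l') D v u + half_sum l' else 0.

Lemma half_sumE l : \sum_(u <- l) \sum_(v <- l) D u v = 2 * half_sum l.
Proof.
elim: l => [|v l IH] /=; first by rewrite big_nil mulr0.
rewrite !big_cons D0; under [X in _ + X]eq_bigr do rewrite big_cons.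
rewrite big_split /= IH; under [X in _ + (X + _)]eq_bigr do rewrite symD.
ring.
Qed.

Lemma le_sum_mem (F : T -> R) l w : (forall u, 0 <= F u) -> w \in l -> F w <= \sum_(u <- l) F u.
Proof.
move=> F0; elim: l => // v l IH; rewrite inE big_cons => /orP[/eqP ->|/IH h].
  by rewrite lerDl sumr_ge0.
by apply: le_trans h _; rewrite lerDr.
Qed.

Lemma half_sum_cat l1 l2 :
  half_sum l2 + \sum_(v <- l1) \sum_(u <- l2) D v u <= half_sum (l1 ++ l2).
Proof.
elim: l1 => [|v l1 IH] /=; first by rewrite big_nil addr0.
rewrite big_cons big_cat /= addrCA -addrA.
have : 0 <= \sum_(u <- l1) D v u by apply: sumr_ge0.
lra.
Qed.

(** As [y] sits in [l1], its pair with [w] is not among the pairs inside [l2]. *)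
Lemma half_sum_extra l1 l2 y w : y \in l1 -> w \in l1 ++ l2 ->
  half_sum l2 + D y w <= half_sum (l1 ++ l2).
Proof.
elim: l1 => // v l1 IH; rewrite [y \in _]inE [w \in _]inE /=.
have ge0 : 0 <= \sum_(u <- l1 ++ l2) D v u by apply: sumr_ge0.
have h2 : half_sum l2 <= half_sum (l1 ++ l2).
  by apply: le_trans (half_sum_cat _ _); rewrite lerDl sumr_ge0 // => i _; apply: sumr_ge0.
have mem u : u \in l1 ++ l2 -> D v u <= \sum_(u <- l1 ++ l2) D v u by apply: le_sum_mem.
have [->|_] /= := eqVneq y v => yl; have [->|_] /= := eqVneq w v => wl.
- by rewrite D0; lra.
- by have := mem w wl; lra.
- by have := mem y; rewrite mem_cat yl symD => /(_ isT); lra.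
- by have := IH yl wl; lra.
Qed.

End HalfSum.

(** * Energy as a sum over pairs of vertices *)

Section EdgeSum.
Variables (R : realType) (n : nat) (e : rel 'I_n) (f : 'I_n -> R).
Hypothesis syme : symmetric e.
Notation D := (edge_energy e f).

Lemma edge_energy_sym u v : D u v = D v u.
Proof. by rewrite /edge_energy syme -sqrrN opprB. Qed.

Lemma edge_energy_diag u : D u u = 0.
Proof. by rewrite /edge_energy subrr expr0n mul0rn. Qed.

Lemma energy_half_sum W : perm_eq W (enum 'I_n) -> energy e f = half_sum D W.
Proof.
move=> pW; apply: (mulfI (x := 2)); first by rewrite pnatr_eq0.
rewrite energy_edges // -half_sumE; [|exact: edge_energy_sym|exact: edge_energy_diag].
rewrite (perm_big _ pW) /= big_enum; apply: eq_bigr => u _.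
by rewrite (perm_big _ pW) /= big_enum.
Qed.

Lemma half_sum_path q s : path e q s -> chain (f q) (map f s) <= half_sum D (q :: s).
Proof.
elim: s q => [|x s IH] q /=; first by rewrite big_nil addr0.
move=> /andP[qx /IH] /= h; rewrite big_cons.
have -> : D q x = (f q - f x) ^+ 2 by rewrite /edge_energy qx.
have : 0 <= \sum_(u <- s) D q u by apply: sumr_ge0 => u _; apply: edge_energy_ge0.
by move: h; lra.
Qed.

End EdgeSum.

(** * Lower bound for the energy of an eigenfunction *)

Section LowerBound.
Variables (R : realType) (n : nat) (e : rel 'I_n).
Hypothesis twb : tree_with_boundary e.
Variables (f : 'I_n -> R).
Let syme := twb_sym twb.
Notation D := (edge_energy e f).

Let symD := edge_energy_sym f syme.
Let D0 := edge_energy_diag e f.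
Let Dge := edge_energy_ge0 e f.

Definition leaf_energy b := \sum_u D b u.

Lemma leaf_energy_single b w : b \in boundary e -> e b w -> leaf_energy b = D b w.
Proof.
move=> bb bw; rewrite /leaf_energy (bigD1 w) //= big1 ?addr0; last first.
  move=> u uw; rewrite /edge_energy; case bu: (e b u); rewrite ?mulr0n //.
  by rewrite (leaf_nbr_unique bb bu bw) eqxx in uw.
by [].
Qed.

(** Three disjoint families of pairs are counted: the steps of the path, the leaf edges off the
    path, and optionally one pair [X] of interior vertices not both on the path. The option serves
    to derive a strict inequality. *)
Lemma energy_lower q s (X : R) : path e q s -> uniq (q :: s) ->
  (X = 0 \/ exists y w, [/\ y \in interior e, w \in interior e, y \notin q :: s & X = D y w]) ->
  chain (f q) (map f s) + X + \sum_(b in boundary e | b \notin q :: s) leaf_energy b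
    <= energy e f.
Proof.
move=> pq uq hX.
(* Vertices are listed as off-path leaves [L], then off-path interior vertices [O], then the path,
   so that each leaf in [L] finds its only neighbour later in the list. *)
pose O := [seq u <- enum 'I_n | (u \in interior e) && (u \notin q :: s)].
pose L := [seq u <- enum 'I_n | (u \in boundary e) && (u \notin q :: s)].
have intO u : u \in interior e -> u \in O ++ (q :: s).
  by move=> ui; rewrite mem_cat mem_filter ui mem_enum /= andbT; case: (u \in q :: s).
have pW : perm_eq (L ++ O ++ q :: s) (enum 'I_n).
  apply: uniq_perm; rewrite ?enum_uniq //; last first.
    move=> u; rewrite mem_cat [u \in O ++ _]mem_cat [u \in L]mem_filter [u \in O]mem_filter !mem_enum !andbT.
    rewrite -(notin_interior twb) -/(u \in q :: s).
    by case: (u \in q :: s); rewrite ?orbT //=; case: (u \in interior e).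
  rewrite !cat_uniq; apply/and3P; split; first by rewrite filter_uniq ?enum_uniq.
    apply/hasPn => u; rewrite mem_cat => /orP[|uq']; last by rewrite mem_filter uq' andbF.
    by rewrite [u \in O]mem_filter [u \in mem L]mem_filter -(notin_interior twb) => /andP[/andP[->]].
  apply/and3P; split=> //; first by rewrite filter_uniq ?enum_uniq.
  by apply/hasPn => u uq'; rewrite mem_filter uq' andbF.
rewrite (energy_half_sum f syme pW).
have h1 := half_sum_cat Dge L (O ++ q :: s).
have h2 : chain (f q) (map f s) + X <= half_sum D (O ++ q :: s).
  apply: le_trans (_ : half_sum D (q :: s) + X <= _); first by rewrite lerD2r half_sum_path.
  case: hX => [->|[y [w [yi wi yq ->]]]].
    rewrite addr0; apply: le_trans (half_sum_cat Dge _ _).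
    by rewrite lerDl sumr_ge0 // => i _; apply: sumr_ge0.
  apply: half_sum_extra => //; last exact: intO.
  by rewrite mem_filter yi yq mem_enum.
apply: le_trans h1; apply: lerD => //.
rewrite /L big_filter big_enum_cond /=; apply: ler_sum => b /andP[bb _].
have [w bw] := leaf_nbr_exists bb.
have wi := leaf_nbr_interior twb bb bw.
rewrite (leaf_energy_single bb bw).
by apply: (@le_sum_mem _ _ (D b)) => //; apply: intO.
Qed.

Hypothesis f0 : dirichlet_fun e f.

Lemma leaf_energyE b w : b \in boundary e -> e b w -> leaf_energy b = f w ^+ 2.
Proof.
move=> bb bw; rewrite (leaf_energy_single bb bw).
by rewrite /edge_energy bw mulr1n (f0 (x := b)) ?(notin_interior twb) // sub0r sqrrN.
Qed.

Hypothesis fpos : forall x, x \in interior e -> 0 < f x.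
Variables (q x p : 'I_n) (t : seq 'I_n).
Hypotheses (pq : path e q (rcons (x :: t) p)) (uq : uniq (q :: rcons (x :: t) p)).
Hypotheses (qb : q \in boundary e) (pb : p \in boundary e).
Hypotheses (ti : {subset x :: t <= interior e}).
Hypotheses (xmin : forall y, y \in interior e -> f x <= f y).

Let xi : x \in interior e. Proof. by apply: ti; rewrite inE eqxx. Qed.

Let mem_off b : b \in boundary e -> (b \notin q :: rcons (x :: t) p) = (b \notin [set p; q]).
Proof.
move=> bb; rewrite in_cons mem_rcons in_cons in_set2; congr (~~ _).
have -> : b \in x :: t = false :> bool.
  by apply/negP => /ti; rewrite (boundary_notin_interior twb).
by rewrite orbF orbC.
Qed.

Lemma two_leaves : p != q /\ [set p; q] \subset boundary e.
Proof.
split; last by apply/subsetP => b; rewrite !inE => /orP[] /eqP ->; [move: pb|move: qb]; rewrite inE.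
by apply: contraTneq uq => ->; rewrite cons_uniq mem_rcons inE eqxx.
Qed.

Lemma card_boundary_ge2 : (2 <= #|boundary e|)%N.
Proof.
have [ne sub] := two_leaves.
by apply: leq_trans (subset_leq_card sub); rewrite cards2 ne.
Qed.

Lemma card_off_leaves : #|boundary e :\: [set p; q]| = (#|boundary e| - 2)%N.
Proof.
have [ne sub] := two_leaves.
by rewrite cardsD (setIidPr sub) cards2 ne.
Qed.

(** The two leaves [p] and [q] are paid for by the chain; every other leaf is charged the least
    possible cost [f x ^+ 2]. *)
Definition path_bound :=
  chain 0 (rcons (map f (x :: t)) 0) + (f x ^+ 2) *+ (#|boundary e| - 2).

Lemma chain_frame : chain (f q) (map f (rcons (x :: t) p)) = chain 0 (rcons (map f (x :: t)) 0).
Proof. by rewrite map_rcons !(f0 (x := _)) ?(notin_interior twb). Qed.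

Lemma leaf_energy_ge b : b \in boundary e -> f x ^+ 2 <= leaf_energy b.
Proof.
move=> bb; have [w bw] := leaf_nbr_exists bb.
have wi := leaf_nbr_interior twb bb bw.
by rewrite (leaf_energyE bb bw) ler_sqr ?xmin // nnegrE ltW // fpos.
Qed.

Lemma off_leaves_sum :
  \sum_(b in boundary e | b \notin q :: rcons (x :: t) p) leaf_energy b =
  \sum_(b in boundary e :\: [set p; q]) leaf_energy b.
Proof.
apply: eq_bigl => b; rewrite in_setD andbC.
by case bb: (b \in boundary e); rewrite ?andbF ?andbT // mem_off.
Qed.

Lemma off_leaves_ge :
  (f x ^+ 2) *+ (#|boundary e| - 2) <= \sum_(b in boundary e :\: [set p; q]) leaf_energy b.
Proof.
rewrite -card_off_leaves -sumr_const; apply: ler_sum => b /setDP[bb _].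
exact: leaf_energy_ge.
Qed.

Lemma path_bound_le : path_bound <= energy e f.
Proof.
have := energy_lower pq uq (or_introl (erefl 0)).
by rewrite chain_frame off_leaves_sum addr0; apply: le_trans; rewrite lerD2l off_leaves_ge.
Qed.

Variable lam : R.
Hypotheses (ef : eigenfun e lam f) (lam0 : 0 < lam).

(** No slack is left. If [y] has a leaf, the cost [f y ^+ 2] of that edge cannot exceed the allotted
    [f x ^+ 2]; if not, [y] has an interior edge of positive energy that the bound does not
    count. *)
Lemma off_path_min y : energy e f <= path_bound -> y \in interior e -> y \notin x :: t ->
  f y = f x.
Proof.
move=> le yi yt.
have yP : y \notin q :: rcons (x :: t) p.
  rewrite in_cons mem_rcons in_cons (negPf yt) orbF negb_or.
  by apply/andP; split; apply: contraTneq yi => ->; rewrite (notin_interior twb).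
case: (pickP [pred b | (b \in boundary e) && e b y]) => [b /andP[bb bY]|nob].
  apply/eqP; rewrite eq_le xmin // andbT.
  rewrite -ler_sqr; [|by rewrite nnegrE ltW // fpos..]; rewrite -(leaf_energyE bb bY).
  have := energy_lower pq uq (or_introl (erefl 0)).
  rewrite chain_frame off_leaves_sum addr0 => /le_trans /(_ le).
  rewrite lerD2l => h.
  have bO : b \in boundary e :\: [set p; q].
    rewrite in_setD bb andbT -mem_off // in_cons mem_rcons in_cons.
    apply/norP; split; [|apply/norP; split].
    - apply: contraNneq yt => E; move: pq => /= /andP[qx _]; rewrite E in bY.
      by rewrite (leaf_nbr_unique qb bY qx) inE eqxx.
    - apply: contraNneq yt => E; move: pq; rewrite rcons_path => /andP[_ lp].
      by rewrite E in bY; rewrite syme in lp; rewrite (leaf_nbr_unique pb bY lp) (mem_last x t).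
    - by apply/negP => /ti; rewrite (boundary_notin_interior twb).
  move: h; rewrite -card_off_leaves (cardsD1 b) bO mulrS (big_setD1 b) //= => h.
  have : (f x ^+ 2) *+ #|boundary e :\: [set p; q] :\ b| <=
     \sum_(b0 in boundary e :\: [set p; q] :\ b) leaf_energy b0.
    rewrite -sumr_const; apply: ler_sum => c /setD1P[_ /setDP[cb _]].
    exact: leaf_energy_ge.
  by move: h; lra.
have allint w : e y w -> w \in interior e.
  move=> yw; have := nob w; rewrite /= syme yw andbT -(notin_interior twb).
  by move/negbFE.
(* The equation at [y] has the positive right side [lam * f y], so [f] is not constant around
   [y]. *)
have [w yw fw] : exists2 w, e y w & f w != f y.
  case: (pickP [pred w | e y w && (f w != f y)]) => [w /andP[]|h]; first by exists w.
  have := mulr_gt0 lam0 (fpos yi); rewrite -ef // /lap big1 ?ltxx // => w _.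
  have := h w => /=; case: (e y w); rewrite ?mulr0n //= => /negbFE/eqP ->.
  by rewrite subrr mul0rn.
have hX : D y w = 0 \/ exists y0 w0, [/\ y0 \in interior e, w0 \in interior e,
    y0 \notin q :: rcons (x :: t) p & D y w = D y0 w0].
  by right; exists y, w; split=> //; apply: allint.
have := energy_lower pq uq hX; rewrite chain_frame off_leaves_sum => h.
have := off_leaves_ge.
have : 0 < D y w by rewrite /edge_energy yw mulr1n exprn_even_gt0 //= subr_eq0 eq_sym.
by move: h le; rewrite /path_bound; lra.
Qed.

End LowerBound.

(** * The labelled comet *)

(* Label [0] is the vertex carrying the bunch of leaves, labels [0 .. k-1] form the
   interior path, [k] is the leaf at its far end, and the labels above [k] are the
   leaves attached to [0]; every label [j > 0] has exactly one smaller neighbour. *)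
Definition comet_parent (k j : nat) : nat := if (j <= k)%N then j.-1 else 0%N.

Definition comet_adj (k i j : nat) : bool :=
  ((0 < j) && (i == comet_parent k j) || (0 < i) && (j == comet_parent k i))%N.

Lemma comet_adj_sym k i j : comet_adj k i j = comet_adj k j i.
Proof. by rewrite /comet_adj orbC. Qed.

Lemma comet_adj_lt k i j : (i < j)%N -> comet_adj k i j = (i == comet_parent k j).
Proof. by rewrite /comet_adj /comet_parent; do 2!case: ifP; lia. Qed.

Lemma comet_adj_irr k i : comet_adj k i i = false.
Proof. by rewrite /comet_adj /comet_parent; case: ifP; lia. Qed.

Lemma comet_adj0 k i : (0 < k)%N -> comet_adj k 0 i = (i == 1%N) || (k < i)%N.
Proof. by rewrite /comet_adj /comet_parent; do ?case: ifP; lia. Qed.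

Lemma comet_adj_leaf k i j : (k <= i)%N -> (0 < k)%N -> comet_adj k i j = (j == comet_parent k i).
Proof. by rewrite /comet_adj /comet_parent; do ?case: ifP; lia. Qed.

Lemma comet_adj_mid k i j : (0 < i < k)%N -> comet_adj k i j = (j == i.-1) || (j == i.+1).
Proof. by rewrite /comet_adj /comet_parent; do ?case: ifP; lia. Qed.

Definition comet_label n k (G : rel 'I_n) (w : nat -> 'I_n) : Prop :=
  [/\ {in gtn n &, injective w},
      forall i j, (i < n)%N -> (j < n)%N -> G (w i) (w j) = comet_adj k i j &
      forall i, (i < n)%N -> (w i \in interior G) = (i < k)%N].

(** * The standard comet lies in the class *)

Section Standard.
Variables (n k : nat).
Hypotheses (k1 : (1 <= k)%N) (kn : (k.+2 <= n)%N).

Definition std_comet : rel 'I_n := fun i j => comet_adj k i j.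

Let n0 : (0 < n)%N. Proof. by lia. Qed.
Let o (i : nat) : 'I_n := insubd (Ordinal n0) i.
Let oE i : (i < n)%N -> o i = i :> nat. Proof. by move=> h; rewrite /o val_insubd h. Qed.

Lemma std_interior (i : 'I_n) : (i \in interior std_comet) = (i < k)%N.
Proof.
rewrite inE; case: (ltnP i k) => ik.
  apply/card_gt1P; have [i0|i0] := posnP i.
    (* Label 0 has the neighbours 1 and [k.+1]; the latter exists because [k.+2 <= n]. *)
    exists (o 1), (o k.+1); rewrite !inE /std_comet !i0 !oE ?comet_adj0; try lia.
    by split; [|lia|apply/eqP => /(congr1 val) /=; rewrite !oE; lia].
  exists (o i.-1), (o i.+1); rewrite !inE /std_comet.
  have := ltn_ord i => lin.
  rewrite !comet_adj_mid ?oE; try lia.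
  by split; [lia|lia|apply/eqP => /(congr1 val) /=; rewrite !oE; lia].
apply/negbTE; rewrite -leqNgt; apply/card_le1P => a; rewrite inE /std_comet comet_adj_leaf //.
move=> /eqP ea b; rewrite !inE comet_adj_leaf // -val_eqE /= ea.
by [].
Qed.

Lemma std_boundary (i : 'I_n) : (i \in boundary std_comet) = (k <= i)%N.
Proof.
have lin := ltn_ord i.
have pos : (0 < deg std_comet i)%N.
  have [i0|i0] := posnP i.
    by apply/card_gt0P; exists (o 1); rewrite inE /std_comet i0 oE ?comet_adj0; lia.
  apply/card_gt0P; exists (o (comet_parent k i)).
  have h : (comet_parent k i < i)%N by rewrite /comet_parent; case: ifP; lia.
  by rewrite inE /std_comet comet_adj_sym oE ?comet_adj_lt //; lia.
have := std_interior i; rewrite !inE => h.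
by rewrite leqNgt -h; move: pos; case: (deg _ _) => [|[|]].
Qed.

(** Each positive label has exactly one smaller neighbour. Descending to it repeatedly reaches 0,
    whence connectedness; the largest label on a cycle would have two distinct smaller
    neighbours. *)
Lemma std_tree : tree_with_boundary std_comet.
Proof.
have syms : symmetric std_comet by move=> i j; apply: comet_adj_sym.
split; last 2 first.
- by apply/set0Pn; exists (o k); rewrite std_boundary oE; lia.
- by apply/set0Pn; exists (o 0); rewrite std_interior oE; lia.
- split.
  + by split=> // i; apply: comet_adj_irr.
  + have c0 m : forall i : 'I_n, (i <= m)%N -> connect std_comet i (o 0).
      elim: m => [|m IH] i im.
        by have -> : i = o 0 by apply/val_inj; rewrite /= oE; lia.
      have [i0|i0] := posnP i.
        by apply: IH; lia.
      have h : (comet_parent k i < i)%N by rewrite /comet_parent; case: ifP; lia.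
      have hn : (comet_parent k i < n)%N by apply: ltn_trans h (ltn_ord i).
      apply: (connect_trans (y := o (comet_parent k i))).
        by apply: connect1; rewrite /std_comet comet_adj_sym oE // comet_adj_lt.
      by apply: IH; rewrite oE //; lia.
    move=> x y; apply: (connect_trans (c0 x x (leqnn _))).
    by rewrite sym_connect_sym //; apply: (c0 y).
  move=> x p up sp pp; apply/negP => ex.
  have cp : cycle std_comet (x :: p) by rewrite /= rcons_path pp.
  have [m ms mmax] : exists2 m, m \in x :: p & forall y, y \in x :: p -> (y <= m)%N.
    case: (@arg_maxnP _ x (mem (x :: p)) val); first by rewrite /= inE eqxx.
    by move=> m ms h; exists m.
  have [i s E] := rot_to ms.
  have us : uniq (m :: s) by rewrite -E rot_uniq.
  have cs : cycle std_comet (m :: s) by rewrite -E rot_cycle.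
  have ss : (2 <= size s)%N by rewrite -ltnS -[(size s).+1]/(size (m :: s)) -E size_rot.
  have par y : y \in s -> std_comet m y -> y = comet_parent k m :> nat.
    move=> ys my.
    have ym : (y <= m)%N by apply: mmax; rewrite -(mem_rot i) E inE ys orbT.
    have yne : (y != m :> nat)%N.
      by apply: contraTneq ys => /val_inj ->; move: us => /= /andP[].
    move: my; rewrite /std_comet comet_adj_sym comet_adj_lt; last by rewrite ltn_neqAle yne.
    by move/eqP.
  case: s us cs ss par {E} => // a s us; rewrite [cycle _ _]/= rcons_path.
  case/lastP: s us => // s b us /and3P[ma _ bm] _ par.
  rewrite last_rcons in bm.
  have Ea := par a (mem_head _ _) ma.
  have Eb : b = comet_parent k m :> nat.
    by apply: par; rewrite ?inE ?mem_rcons ?inE ?eqxx ?orbT // syms.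
  move: us; have -> : a = b by apply/val_inj; rewrite /= Ea Eb.
  by rewrite /= mem_rcons inE eqxx andbF.
- move=> i; have := std_boundary i; have := std_interior i; rewrite !inE.
  by case: (deg _ _) => [|//]; lia.
Qed.

Lemma std_in_class : in_class_T k std_comet.
Proof.
split; first exact: std_tree.
have h : (k <= n)%N by lia.
have -> : interior std_comet = [set widen_ord h i | i : 'I_k].
  apply/setP => i; rewrite std_interior; apply/idP/imsetP => [ik|[j _ ->]]; last exact: (ltn_ord j).
  by exists (Ordinal ik) => //; apply/val_inj.
by rewrite card_imset ?card_ord // => i j /(congr1 val) /= /val_inj.
Qed.

Lemma std_is_comet : comet k std_comet.
Proof.
(* The definition of [comet] puts the bunch of leaves at the end of the path, the labels put it at
   0; hence the reversal. *)
exists (fun i => o (k.-1 - i)); split.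
- move=> i j; rewrite !inE => ik jk /(congr1 val) /=; rewrite !oE; lia.
- by move=> i ik; rewrite std_interior oE; lia.
- move=> i ik; rewrite /std_comet comet_adj_sym !oE; try lia.
  by rewrite comet_adj_lt; [rewrite /comet_parent; case: ifP; lia | lia].
- move=> k2; apply/eqP/cards1P; exists (o k); apply/setP => b.
  rewrite inE std_boundary /std_comet !inE -val_eqE /= !oE; try lia.
  case kb: (k <= b)%N; last by lia.
  rewrite comet_adj_sym comet_adj_leaf ?kb //= /comet_parent subn0; case: ifP; lia.
- move=> b; rewrite std_boundary => kb; rewrite /std_comet !oE; try lia.
  rewrite ![comet_adj _ _ b]comet_adj_sym !comet_adj_leaf // /comet_parent; case: ifP; lia.
Qed.

End Standard.

(** * Labelling an arbitrary comet *)

Section Labelling.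
Variables (n k : nat) (G : rel 'I_n).
Hypotheses (k1 : (1 <= k)%N) (GT : in_class_T k G).
Let twb : tree_with_boundary G := proj1 GT.
Let cardI : #|interior G| = k := proj2 GT.
Let symG := twb_sym twb.

(** A chord would close a cycle with the segment of the path between its ends. *)
Lemma tree_path_no_chord (v : nat -> 'I_n) a b :
  {in gtn k &, injective v} -> (forall i, (i.+1 < k)%N -> G (v i) (v i.+1)) ->
  (a < b)%N -> (b < k)%N -> G (v a) (v b) = (b == a.+1).
Proof.
move=> injv adjv ab bk; apply/idP/eqP => [Gab|E]; last first.
  by rewrite E; apply: adjv; rewrite -E.
apply/eqP; rewrite eqn_leq ab andbT leqNgt; apply/negP => ab2.
have [m Em] : exists m, b = (a + m)%N by exists (b - a)%N; lia.
have pathv : forall m c, (c + m < k)%N -> path G (v c) (map v (iota c.+1 m)).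
  elim=> //= m' IH c h; rewrite adjv ?IH //; lia.
have u1 : uniq (v a :: map v (iota a.+1 m)).
  rewrite -map_cons -[a :: _]/(iota a m.+1) map_inj_in_uniq ?iota_uniq // => i j.
  by rewrite !mem_iota => hi hj; apply: injv; rewrite inE; lia.
have := twb_acyclic twb u1 _ (pathv m a _); rewrite size_map size_iota last_map.
have -> : last a (iota a.+1 m) = b.
  by rewrite Em; elim: (m) (a) => [|m' IH] c /=; rewrite ?addn0 // IH addSnnS.
by rewrite symG Gab => acyc; suff: ~~ true by []; apply: acyc; lia.
Qed.

(** Labels run backwards along the path, then to the lone leaf [l] at [v 0], then through the other
    leaves. Adjacency is then forced: the path has no chords and a leaf has one neighbour. *)
Lemma comet_labelling : comet k G -> exists w, comet_label k G w.
Proof.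
case=> v [injv vi adjv lone lall].
have [[_ _ _] _ /set0Pn[b0 b0b] _] := twb.
have intE : interior G = [set v i | i : 'I_k].
  apply/esym/eqP; rewrite eqEcard cardI card_in_imset ?card_ord ?leqnn ?andbT.
    by apply/subsetP => _ /imsetP[i _ ->]; apply: vi.
  by move=> i j _ _ /injv E; apply/val_inj; apply: E; rewrite inE ltn_ord.
(* For [k = 1] no lone leaf is singled out, and any leaf [b0] serves. *)
have [l lb [l0 lu]] : exists2 l, l \in boundary G & G (v 0%N) l /\
    forall b, b \in boundary G -> b != l -> G (v k.-1) b.
  have [E|k2] : (k = 1 \/ 2 <= k)%N by lia.
    exists b0 => //; move: lall; rewrite E /= => lall.
    by split=> [|b bb _]; [have := lall b0 b0b | have := lall b bb]; rewrite orbb.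
  have /eqP/cards1P[l /setP El] := lone k2.
  have := El l; rewrite !inE eqxx => /andP[lb l0]; exists l; rewrite ?inE //; split=> // b bb bl.
  have := lall b bb; have := El b; rewrite in_set1 (negPf bl) in_set bb /= => -> .
  by [].
pose Ls := enum (boundary G :\ l).
pose W := [seq v (k.-1 - i)%N | i <- iota 0 k] ++ l :: Ls.
have cardB : #|boundary G| = (n - k)%N.
  by rewrite boundary_setC // cardsCs setCK cardI card_ord.
have cardBl : (#|boundary G| = #|boundary G :\ l|.+1)%N by rewrite (cardsD1 l) lb.
have sW : size W = n.
  rewrite size_cat size_map size_iota /= -cardE -cardBl cardB subnKC //.
  by rewrite -cardI -[leqRHS]card_ord max_card.
have memv i : (i < k)%N -> v i \in interior G by apply: vi.
have uW : uniq W.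
  rewrite cat_uniq; apply/and3P; split.
  - rewrite map_inj_in_uniq ?iota_uniq // => i j; rewrite !mem_iota => hi hj E.
    have : (k.-1 - i = k.-1 - j)%N by apply: injv => //; rewrite inE; lia.
    lia.
  - apply/hasPn => b bl; apply/negP => /mapP[i]; rewrite mem_iota => hi Eb.
    have : b \in boundary G.
      by move: bl; rewrite inE mem_enum => /orP[/eqP -> //|/setD1P[]].
    rewrite -(notin_interior twb) Eb memv //; lia.
  - by rewrite /= enum_uniq mem_enum !inE eqxx.
pose w i := nth b0 W i.
have w1 i : (i < k)%N -> w i = v (k.-1 - i)%N.
  move=> ik; rewrite /w nth_cat size_map size_iota ik (nth_map 0%N) ?size_iota //.
  by rewrite nth_iota.
have w2 : w k = l by rewrite /w nth_cat size_map size_iota ltnn subnn.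
have w3 i : (k < i)%N -> (i < n)%N -> w i \in boundary G /\ w i != l.
  move=> ki iN.
  have : w i \in Ls.
    rewrite /w nth_cat size_map size_iota ltnNge (ltnW ki) /=.
    have -> : (i - k)%N = (i - k).-1.+1 by lia.
    rewrite /=; apply: mem_nth; move: sW; rewrite size_cat size_map size_iota /=; lia.
  by rewrite mem_enum => /setD1P[].
have injw : {in gtn n &, injective w}.
  by move=> i j; rewrite !inE => hi hj /eqP; rewrite nth_uniq ?sW // => /eqP.
have wint i : (i < n)%N -> (w i \in interior G) = (i < k)%N.
  move=> iN; case: (ltngtP i k) => [ik|ki|->].
  - by rewrite w1 // memv //; lia.
  - by have [h _] := w3 i ki iN; rewrite (boundary_notin_interior twb).
  - by rewrite w2 (boundary_notin_interior twb).
exists w; split=> //.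
have leafadj u i j : (i < n)%N -> (j < n)%N -> w j \in boundary G -> G (w u) (w j) -> (u < n)%N ->
    G (w i) (w j) = (i == u).
  move=> iN jN bj Gu uN; apply/idP/eqP => [Gi|-> //].
  by apply: injw => //; apply: (leaf_nbr_unique bj); rewrite symG.
have main i j : (i < j)%N -> (j < n)%N -> G (w i) (w j) = (i == comet_parent k j).
  move=> ij jN; have iN := ltn_trans ij jN.
  have kN : (k < n)%N by have := max_card (boundary G); have : (0 < #|boundary G|)%N by [rewrite cardBl]; lia.
  rewrite /comet_parent; case: (ltngtP j k) => [jk|kj|E].
  - rewrite !w1 //; last by lia.
    rewrite symG tree_path_no_chord //; lia.
  - have [bj jl] := w3 j kj jN.
    apply: leafadj => //; last by lia.
    by rewrite w1 // subn0; apply: lu.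
  - rewrite E in jN *; apply: leafadj => //; rewrite ?w2 //; last by lia.
    by rewrite w1 ?subnn //; lia.
move=> i j iN jN; case: (ltngtP i j) => [ij|ji|->].
- by rewrite comet_adj_lt // main.
- by rewrite comet_adj_sym symG comet_adj_lt // main.
- by rewrite comet_adj_irr (twb_irr twb).
Qed.

End Labelling.

Lemma comet_label_iso n k (G H : rel 'I_n) w w' :
  comet_label k G w -> comet_label k H w' -> graph_iso G H.
Proof.
move=> [iw aw _] [iw' aw' _].
have b (u : nat -> 'I_n) : {in gtn n &, injective u} -> bijective (fun i : 'I_n => u i).
  by move=> iu; apply: injF_bij => i j /iu E; apply/val_inj/E; rewrite inE ltn_ord.
have [h hK Kh] := b w iw; have [h' hK' Kh'] := b w' iw'.
exists (fun x => w' (h x)); split.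
  by exists (fun y => w (h' y)) => x; [rewrite hK' Kh | rewrite hK Kh'].
by move=> x y; rewrite aw' // -aw // Kh Kh.
Qed.

(** * Energy of a function on a comet *)

Section CometEnergy.
Variables (R : realType) (n k : nat) (G : rel 'I_n) (w : nat -> 'I_n).
Hypotheses (k1 : (1 <= k)%N) (kn : (k < n)%N) (symG : symmetric G).
Hypothesis lw : comet_label k G w.
Variables (s : seq R) (g : 'I_n -> R).
Hypotheses (ss : size s = k) (gE : forall i, (i < n)%N -> g (w i) = s`_i).

Let injw : {in gtn n &, injective w}. Proof. by case: lw. Qed.
Let adjw i j : (i < n)%N -> (j < n)%N -> G (w i) (w j) = comet_adj k i j.
Proof. by case: lw => _ h _; apply: h. Qed.

Lemma perm_label : perm_eq (mkseq w n) (enum 'I_n).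
Proof.
have u : uniq (mkseq w n).
  by rewrite map_inj_in_uniq ?iota_uniq // => i j; rewrite !mem_iota => hi hj; apply: injw.
apply: uniq_perm; rewrite ?enum_uniq // => x; rewrite mem_enum.
have sub : {subset mkseq w n <= enum 'I_n} by move=> y _; rewrite mem_enum.
have [|_ ->] := uniq_min_size u sub; last by rewrite mem_enum.
by rewrite size_mkseq size_enum_ord.
Qed.

Lemma sum_label (F : 'I_n -> R) : \sum_x F x = \sum_(0 <= i < n) F (w i).
Proof.
rewrite -[LHS]big_enum /= -(perm_big _ perm_label) /= /mkseq big_map.
by rewrite /index_iota subn0.
Qed.

Lemma chainE a t : chain a t = \sum_(0 <= i < size t) (nth 0 (a :: t) i - t`_i) ^+ 2 :> R.
Proof.
elim: t a => [|b t IH] a; first by rewrite big_nil.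
by rewrite big_nat_recl //= IH.
Qed.

(** With the labels in decreasing order, each one is adjacent to only its parent among those that
    follow. *)
Lemma half_sum_label m : (0 < m)%N -> (m <= n)%N ->
  half_sum (edge_energy G g) (rev (mkseq w m)) =
  \sum_(1 <= j < m) (s`_j - s`_(comet_parent k j)) ^+ 2.
Proof.
elim: m => // -[_ _ _|m IH _ mn]; first by rewrite /= !big_nil addr0.
rewrite mkseqS rev_rcons [LHS]/= IH // 1?ltnW // [RHS]big_nat_recr //= addrC; congr (_ + _).
rewrite (perm_big _ (permEl (perm_rev _))) /mkseq big_map.
set p := comet_parent k m.+1.
have pm : (p < m.+1)%N by rewrite /p /comet_parent; case: ifP; lia.
rewrite -[iota 0 _]/(index_iota 0 m.+1) big_mkord (bigD1 (Ordinal pm)) //= big1 ?addr0.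
  rewrite /edge_energy adjw ?(ltn_trans pm) // comet_adj_sym comet_adj_lt //.
  by rewrite -/p eqxx mulr1n !gE // (ltn_trans pm).
move=> i; rewrite -val_eqE /= => ip.
have ltin : (i < n)%N by apply: leq_trans (ltn_ord i) (ltnW mn).
by rewrite /edge_energy adjw // comet_adj_sym comet_adj_lt // -/p (negPf ip).
Qed.

(** Labels up to [k] retrace the walk, whose final 0 is the leaf [k]; the [n - k.+1] labels above
    [k] are leaves joined to label 0. *)
Lemma comet_energy a t : s = a :: t ->
  energy G g = chain a (rcons t 0) + a ^+ 2 *+ (n - k.+1).
Proof.
move=> E; have st : (size t).+1 = k by rewrite -ss E.
have [P1 P2] : perm_eq (rev (mkseq w n)) (enum 'I_n) /\ (0 < n)%N.
  by split; [rewrite perm_rev perm_label | lia].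
rewrite (energy_half_sum g symG P1) half_sum_label // (big_cat_nat (n := k.+1)) //=; congr (_ + _).
  rewrite chainE size_rcons st big_add1 /=; apply: eq_big_nat => i ik.
  have -> : comet_parent k i.+1 = i by rewrite /comet_parent; case: ifP; lia.
  rewrite E -sqrrN opprB /= nth_rcons; congr ((_ - _) ^+ 2).
    by case: i ik => //= i ik; rewrite nth_rcons; case: ltngtP => //; lia.
  case: ltngtP => // h; last by rewrite nth_default // h.
  by rewrite nth_default // ltnW.
rewrite -sumr_const_nat; apply: eq_big_nat => i /andP[ki iN].
have -> : comet_parent k i = 0%N by rewrite /comet_parent; case: ifP; lia.
by rewrite nth_default ?ss 1?ltnW // E sub0r sqrrN.
Qed.

Lemma comet_sqsum : sqsum g = \sum_(v <- s) v ^+ 2.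
Proof.
rewrite /sqsum sum_label (big_cat_nat (n := k)) //= 1?ltnW // [X in _ + X]big1_seq ?addr0.
  rewrite [RHS](big_nth 0) ss; apply: eq_big_nat => i /andP[_ ik].
  by rewrite gE // (ltn_trans ik).
move=> i; rewrite mem_index_iota => /andP[_ /andP[ki iN]].
by rewrite gE // nth_default ?ss // expr0n.
Qed.

Lemma comet_dirichlet : dirichlet_fun G g.
Proof.
move=> x; have : x \in mkseq w n by rewrite (perm_mem perm_label) mem_enum.
case/mapP => i; rewrite mem_iota => /= iN ->; case: lw => _ _ -> // ki.
by rewrite gE // nth_default // ss leqNgt.
Qed.

(** For [k = 1] the list [t] is empty, and the default 0 of [nth] is the value at the leaf labelled
    1. *)
Lemma comet_lap_head a t : s = a :: t ->
  lap G g (w 0) = a - t`_0 + a *+ (n - k.+1).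
Proof.
move=> E; rewrite /lap sum_label.
have n0 : (0 < n)%N by lia.
have -> : \sum_(0 <= i < n) (g (w 0) - g (w i)) *+ G (w 0) (w i) =
    \sum_(0 <= i < n) (a - s`_i) *+ ((i == 1%N) || (k < i)%N).
  by apply: eq_big_nat => i /andP[_ iN]; rewrite adjw // !gE // comet_adj0 // E.
rewrite (big_cat_nat (n := k.+1)) //=; congr (_ + _).
  rewrite big_ltn // big_ltn //= mulr0n add0r E /= mulr1n big1_seq ?addr0 // => i.
  rewrite mem_index_iota => /andP[_ hi].
  by have -> : ((i == 1%N) || (k < i)%N) = false by lia.
rewrite -sumr_const_nat; apply: eq_big_nat => i /andP[ki iN].
by rewrite ki orbT nth_default ?subr0 // ss ltnW.
Qed.

Lemma comet_lap_second a b t : s = a :: b :: t ->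
  lap G g (w 1) = b - a + (b - t`_0).
Proof.
move=> E; have k2 : (1 < k)%N by rewrite -ss E.
have n0 : (1 < n)%N by lia.
rewrite /lap sum_label.
have -> : \sum_(0 <= i < n) (g (w 1) - g (w i)) *+ G (w 1) (w i) =
    \sum_(0 <= i < n) (b - s`_i) *+ ((i == 0%N) || (i == 2%N)).
  by apply: eq_big_nat => i /andP[_ iN]; rewrite adjw // !gE // comet_adj_mid // E.
rewrite big_ltn 1?ltnW // big_ltn // big_ltn; last by lia.
rewrite /= mulr0n add0r !mulr1n E /= big1_seq ?addr0 // => i.
by rewrite mem_index_iota; case: i => [|[|[|i]]].
Qed.

End CometEnergy.

(** * Comparison with the comet *)

Section Comparison.
Variables (R : realType) (n k : nat) (G : rel 'I_n).
Hypotheses (k1 : (1 <= k)%N) (GT : in_class_T k G).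
Let twb : tree_with_boundary G := proj1 GT.
Let cardI : #|interior G| = k := proj2 GT.
Let symG := twb_sym twb.

Lemma card_boundary_class : #|boundary G| = (n - k)%N.
Proof. by rewrite boundary_setC // cardsCs setCK cardI card_ord. Qed.

Lemma comet_of_single_interior : k = 1%N -> comet k G.
Proof.
move=> kE; move: cardI; rewrite kE => /eqP/cards1P[x Ex].
have leaf b : b \in boundary G -> G x b.
  move=> bb; have [y bY] := leaf_nbr_exists bb.
  by have := leaf_nbr_interior twb bb bY; rewrite Ex => /set1P <-; rewrite symG.
exists (fun=> x); split=> //.
- by move=> i j; rewrite !inE => hi hj _; lia.
- by move=> i _; rewrite Ex inE.
- by move=> b /leaf ->.
Qed.

Variables (lG : R) (f : 'I_n -> R).
Hypotheses (f0 : dirichlet_fun G f) (fpos : forall x, x \in interior G -> 0 < f x).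
Hypothesis ef : eigenfun G lG f.

Let fN0 : exists x, f x != 0.
Proof. by have [_ _ _ /set0Pn[x /fpos xi]] := twb; exists x; rewrite lt0r_neq0. Qed.

Let lG0 : 0 < lG. Proof. exact: (pos_eigenvalue twb f0 ef). Qed.

Section OnPath.
Variables (q x p : 'I_n) (t : seq 'I_n).
Hypotheses (pq : path G q (rcons (x :: t) p)) (uq : uniq (q :: rcons (x :: t) p)).
Hypotheses (qb : q \in boundary G) (pb : p \in boundary G).
Hypotheses (ti : {subset x :: t <= interior G}).
Hypotheses (xmin : forall y, y \in interior G -> f x <= f y).
Hypothesis tmax : exists2 z, z \in x :: t & forall y, y \in interior G -> f y <= f z.

Let xi : x \in interior G. Proof. by apply: ti; rewrite inE eqxx. Qed.
Let ut : uniq (x :: t).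
Proof. by move: uq; rewrite cons_uniq rcons_uniq => /andP[_ /andP[]]. Qed.

Lemma class_size : (k.+2 <= n)%N.
Proof.
by have := card_boundary_ge2 uq qb pb; rewrite card_boundary_class ltn_subRL addn1.
Qed.

Lemma full_path_size : {subset interior G <= x :: t} -> size (x :: t) = k.
Proof.
move=> full; rewrite -cardI -(card_uniqP ut); apply: eq_card => y.
by apply/idP/idP => [/ti|/full].
Qed.

(** The comet is read from the far end: it starts at [last x t], with lone leaf [p], and carries its
    bunch at [x]. *)
Lemma comet_of_full_path : (0 < size t)%N ->
  {subset interior G <= x :: t} -> (forall b, b \in boundary G -> b != p -> G x b) ->
  comet k G.
Proof.
move=> t0 full leaf.
have Ek := full_path_size full.
have vE i : (i < k)%N -> nth x (rev (x :: t)) i = nth x (x :: t) (k.-1 - i).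
  by move=> ik; rewrite nth_rev ?Ek // subnS -subn1 -subnDA addnC subnDA subn1.
have v0 : nth x (rev (x :: t)) 0 = last x t.
  by rewrite vE ?subn0 // -Ek /= -[last x t]/(last x (x :: t)) -nth_last.
have pt : G (last x t) p by move: pq; rewrite rcons_path => /andP[].
have pathG : path G x t by move: pq; rewrite rcons_path => /andP[/= /andP[]].
exists (fun i => nth x (rev (x :: t)) i); split.
- move=> i j; rewrite !inE => hi hj /eqP.
  by rewrite nth_uniq ?rev_uniq ?size_rev ?Ek // => /eqP.
- by move=> i ik; apply: ti; rewrite -mem_rev mem_nth // size_rev Ek.
- move=> i ik; rewrite !vE //; last exact: ltnW.
  have ik' : (i < k.-1)%N by rewrite -ltnS prednK.
  rewrite -[(k.-1 - i)%N]prednK ?subn_gt0 // -subnS symG.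
  apply: (pathP x pathG); rewrite -[size t]/(size (x :: t)).-1 Ek.
  by rewrite ltn_subrL (leq_trans _ ik').
- move=> _; rewrite v0; apply/eqP/cards1P; exists p; apply/setP => b; rewrite !inE.
  apply/andP/eqP => [[bb lb]|->]; last by move: pb; rewrite inE.
  (* A second leaf at [last x t] would also be adjacent to [x], forcing [x = last x t]. *)
  apply/eqP; apply: contraTT ut => bp.
  have bb' : b \in boundary G by rewrite inE.
  have xb := leaf b bb' bp; rewrite symG in xb; rewrite symG in lb.
  rewrite -(leaf_nbr_unique bb' lb xb) /=.
  by case: (t) t0 => //= h s _; rewrite mem_last.
- move=> b bb; rewrite v0 vE ?subnn /= ?prednK //.
  by have [->|bp] := eqVneq b p; [rewrite pt | rewrite leaf ?orbT].
Qed.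

Variables (C : rel 'I_n) (lC : R).
Hypotheses (CT : in_class_T k C) (Ccomet : comet k C) (fC : first_dirichlet_eigenvalue C lC).

Let values := [seq f y | y <- enum (interior G)].

Let symC : symmetric C := twb_sym (proj1 CT).

Lemma sqsum_values : sqsum f = \sum_(v <- values) v ^+ 2.
Proof.
rewrite /values big_map big_enum /= /sqsum [LHS](bigID (mem (interior G))) /=.
by rewrite [X in _ + X]big1 ?addr0 // => y /f0 ->; rewrite expr0n.
Qed.

(** The initial step from 0 to [f x] is the edge of the leaf [q]; it joins the bunch, and
    [n - k - 2] becomes [n - k.+1]. *)
Lemma path_boundE :
  path_bound G f x t = chain (f x) (rcons (map f t) 0) + f x ^+ 2 *+ (n - k.+1).
Proof.
have kn := class_size.
rewrite /path_bound card_boundary_class /= sub0r sqrrN.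
have -> : (n - k.+1)%N = (n - k - 2).+1 by lia.
by rewrite mulrS addrCA addrA.
Qed.

(** The rearranged interior values define a function [g] on [C] with the norm of [f], and [lC *
    sqsum g <= energy C g <= path_bound G f x t <= energy G f = lG * sqsum f]. If [lG <= lC],
    equality holds throughout and [g] is a minimiser. *)
Lemma transplant t' : perm_eq (f x :: t') values ->
  chain (f x) (rcons t' 0) <= chain (f x) (rcons (map f t) 0) ->
  exists w g, [/\ comet_label k C w, forall i, (i < n)%N -> g (w i) = nth 0 (f x :: t') i,
    lC <= lG & lG <= lC -> energy G f <= path_bound G f x t /\ eigenfun C lC g].
Proof.
move=> pt' ct'; have kn := class_size.
have [w lw] := comet_labelling k1 CT Ccomet.
have [injw _ _] := lw.
pose s := f x :: t'.
have ss : size s = k by rewrite (perm_size pt') size_map -cardE.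
pose g y := nth 0 s (index y (mkseq w n)).
have uw : uniq (mkseq w n).
  by rewrite map_inj_in_uniq ?iota_uniq // => i j; rewrite !mem_iota => hi hj; apply: injw.
have gE i : (i < n)%N -> g (w i) = nth 0 s i.
  move=> iN; rewrite /g; congr nth.
  by rewrite -(nth_mkseq (w 0%N) w iN) index_uniq ?size_mkseq.
have kn' : (k < n)%N by apply: leq_trans kn.
have gd := comet_dirichlet lw ss gE.
have Eg := comet_energy k1 kn' symC lw ss gE (erefl s).
have Sg : sqsum g = sqsum f.
  by rewrite (comet_sqsum kn' lw ss gE) sqsum_values (perm_big _ pt').
have Ef := eigenfun_energy f0 ef.
have hB := path_bound_le twb f0 fpos pq uq qb pb ti xmin.
have hC := rayleigh symC fC gd.
have Sf := sqsum_gt0 fN0.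
have hEB : energy C g <= path_bound G f x t by rewrite Eg path_boundE lerD2r.
exists w, g; split=> //.
  by rewrite -(ler_pM2r Sf) -Ef -{1}Sg (le_trans hC) // (le_trans hEB).
move=> le; have h : lG * sqsum f <= lC * sqsum g by rewrite Sg ler_pM2r.
split; first by rewrite Ef (le_trans h) // (le_trans hC).
by apply: (rayleigh_eq symC fC gd); apply: le_trans h; rewrite -Ef (le_trans hEB).
Qed.

(** All interior values lie between [f x] and the maximum, which is attained on the path. *)
Lemma insert_off_path (l : seq 'I_n) : {subset l <= interior G} ->
  exists2 t', perm_eq t' (map f l ++ map f t) &
    chain (f x) (rcons t' 0) <= chain (f x) (rcons (map f t) 0).
Proof.
move=> li; have [z zt zmax] := tmax.
apply: (chain_insert_seq (m := f z)); first by rewrite -map_cons map_f.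
by apply/allP => _ /mapP[y /li yi ->]; rewrite xmin ?zmax.
Qed.

Lemma perm_off_path (l : seq 'I_n) :
  perm_eq (l ++ x :: t) (enum (interior G)) -> perm_eq (f x :: map f l ++ map f t) values.
Proof.
move=> pl; rewrite /values; apply: perm_trans (perm_map f pl).
rewrite map_cat perm_sym.
exact: (permEl (perm_catCA (map f l) [:: f x] (map f t))).
Qed.

Lemma off_path_perm :
  perm_eq ([seq y <- enum (interior G) | y \notin x :: t] ++ x :: t) (enum (interior G)).
Proof.
apply: uniq_perm; rewrite ?enum_uniq //.
  rewrite cat_uniq filter_uniq ?enum_uniq // ut andbT andTb.
  by apply/hasPn => y yt; rewrite mem_filter yt.
move=> y; rewrite mem_cat mem_filter mem_enum.
by case yt: (y \in x :: t); rewrite ?orbT ?orbF //= ti.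
Qed.

Lemma comet_eigenvalue_le : lC <= lG.
Proof.
have [y|t' pt' ct'] := insert_off_path (l := [seq y <- enum (interior G) | y \notin x :: t]).
  by rewrite mem_filter mem_enum => /andP[].
have [|w [g []] //] := transplant (t' := t') _ ct'.
by apply: perm_trans (perm_off_path off_path_perm); rewrite perm_cons.
Qed.

Hypothesis t0 : (0 < size t)%N.

Lemma comet_eigenvalue_eq : lG <= lC -> comet k G.
Proof.
move=> le; have kn := class_size.
have Elam : lC = lG by apply/eqP; rewrite eq_le comet_eigenvalue_le le.
have fx := fpos xi.
have le_bound : energy G f <= path_bound G f x t.
  have [y|t' pt' ct'] := insert_off_path (l := [seq y <- enum (interior G) | y \notin x :: t]).
    by rewrite mem_filter mem_enum => /andP[].
  have [|w [g [_ _ _ /(_ le)[] //]]] := transplant (t' := t') _ ct'.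
  by apply: perm_trans (perm_off_path off_path_perm); rewrite perm_cons.
case: (pickP [pred y | (y \in interior G) && (y \notin x :: t)]) => [y /andP[yi yt]|full].
  have fy : f y = f x.
    exact: (off_path_min twb f0 fpos pq uq qb pb ti xmin ef lG0 le_bound).
  pose l := rem y [seq y <- enum (interior G) | y \notin x :: t].
  have pl : perm_eq ((y :: l) ++ x :: t) (enum (interior G)).
    apply: perm_trans off_path_perm; rewrite perm_cat2r perm_sym; apply: perm_to_rem.
    by rewrite mem_filter yt mem_enum.
  have li : {subset l <= interior G}.
    by move=> u ul; rewrite -mem_enum -(perm_mem pl) !inE mem_cat ul orbT.
  have [t1 pt1 ct1] := insert_off_path li.
  (* The value of [y] is placed right after the equal value [f x], at no cost. *)
  have [||w [g [lw gE _ /(_ le)[_ eg]]]] := transplant (t' := f x :: t1).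
  - by apply: perm_trans (perm_off_path pl); rewrite /= fy !perm_cons.
  - by rewrite /= subrr expr0n add0r.
  (* This makes the head of [t1] a value of [f] at an interior vertex and not the default 0. *)
  have st1 : (0 < size t1)%N.
    by rewrite (perm_size pt1) size_cat !size_map ltn_addl.
  have ss : size (f x :: f x :: t1) = k.
    rewrite -cardI cardE -(perm_size pl) /= size_cat /= (perm_size pt1).
    by rewrite size_cat !size_map addnS.
  have k2 : (1 < k)%N by rewrite -ss.
  have kn' : (k < n)%N by apply: leq_trans kn.
  have w1 : w 1 \in interior C by case: lw => _ _ -> //; apply: ltn_trans kn'.
  (* The equation at label 1 says that [f x] minus the head of [t1] is [lG * f x], so that head lies
     below the minimum. *)
  have := eg _ w1; rewrite (comet_lap_second k1 kn' lw ss gE (erefl _)) gE /=; last exact: ltn_trans kn'.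
  rewrite subrr add0r Elam => E.
  have : t1`_0 \in map f l ++ map f t by rewrite -(perm_mem pt1) mem_nth.
  rewrite -map_cat => /mapP[u ul Eu].
  have ui : u \in interior G.
    move: ul; rewrite mem_cat => /orP[/li //|ut'].
    by apply: ti; rewrite inE ut' orbT.
  have := xmin ui; have := mulr_gt0 lG0 fx; rewrite -E Eu; lra.
have fullt : {subset interior G <= x :: t}.
  by move=> y yi; have := full y; rewrite /= yi /= => /negbFE.
apply: comet_of_full_path => //.
have [|w [g [lw gE _ /(_ le)[_ eg]]]] := transplant (t' := map f t) _ (lexx _).
  apply: (perm_off_path (l := [::])); apply: uniq_perm; rewrite ?enum_uniq // => y.
  by rewrite mem_enum; apply/idP/idP => [/ti|/fullt].
have ss : size (f x :: map f t) = k by rewrite /= size_map -(full_path_size fullt).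
have kn' : (k < n)%N by apply: leq_trans kn.
have w0 : w 0 \in interior C by case: lw => _ _ -> //; apply: leq_trans kn'.
(* The equations at label 0 of the comet and at [x] in [G] have the same right side; comparing left
   sides counts the leaves at [x]. *)
have := eg _ w0; rewrite (comet_lap_head k1 kn' lw ss gE (erefl _)) gE /=; last exact: leq_trans kn'.
rewrite Elam -ef // => E.
pose h := nth x t 0; have ht : h \in t by apply: mem_nth.
have hi : h \in interior G by apply: ti; rewrite inE ht orbT.
have Eh : (map f t)`_0 = f h by rewrite (nth_map x).
pose L := [set b in boundary G | G x b].
have Gxh : G x h.
  by move: pq; rewrite /= rcons_path => /andP[_ /andP[]]; rewrite /h; case: (t) t0 => //= ? ? _ /andP[].
have hb : (h \in boundary G) = false by apply: contraTF hi; rewrite (notin_interior twb).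
have lapx : lap G f x <= f x - f h + f x *+ #|L|.
  rewrite /lap (bigD1 h) //= Gxh mulr1n lerD2l -sumr_const [leRHS]big_mkcond /=.
  rewrite [leRHS](bigD1 h) //= in_set hb /= add0r; apply: ler_sum => y _.
  rewrite in_set; case Gy: (G x y); rewrite ?mulr0n ?andbF // andbT mulr1n.
  have [yb|] := boolP (y \in boundary G); first by rewrite (f0 (x := y)) ?subr0 // (notin_interior twb).
  by rewrite -(notin_interior twb) negbK => /xmin; rewrite subr_le0.
have cardL : (n - k.+1 <= #|L|)%N.
  move: lapx; rewrite -E Eh lerD2l => hL.
  by rewrite -(ler_nat R) -(ler_pM2l fx) !mulr_natr.
have pL : p \notin L.
  apply/negP; rewrite inE pb /= => xp; move: pq; rewrite rcons_path => /andP[_ lp].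
  rewrite symG in xp; rewrite symG in lp; have El := leaf_nbr_unique pb lp xp.
  move: ut; rewrite -{1}El /=; case: (t) t0 => //= a s _.
  by rewrite mem_last.
(* [L] misses [p] and has at least [n - k.+1] elements, so it is all the rest of the boundary. *)
have EL : L = boundary G :\ p.
  apply/eqP; rewrite eqEcard; apply/andP; split.
    apply/subsetP => b bL; rewrite in_setD1; move: (bL); rewrite in_set => /andP[-> _].
    by rewrite andbT; apply: contraTneq bL => ->.
  by move: cardL; rewrite subnS -card_boundary_class (cardsD1 p) pb.
by move=> b bb bp; have : b \in L; [rewrite EL in_setD1 bp | rewrite in_set => /andP[]].
Qed.

End OnPath.

End Comparison.

(** * Extremality of the comet *)

Section Extremality.
Variables (R : realType) (n k : nat) (G : rel 'I_n) (lG : R).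
Hypotheses (k1 : (1 <= k)%N) (GT : in_class_T k G) (fG : first_dirichlet_eigenvalue G lG).

(** The two ends of the leaf-to-leaf path are distinct leaves; the standard comet requires this much
    room. *)
Lemma class_nonempty_size : (k.+2 <= n)%N.
Proof.
have twb := proj1 GT; have [f [f0 fpos ef]] := first_eigenfun_pos twb fG.
have fN0 : exists x, f x != 0.
  by have [_ _ _ /set0Pn[x /fpos xi]] := twb; exists x; rewrite lt0r_neq0.
have lG0 := pos_eigenvalue twb f0 ef fN0.
have [q [x [t [p [[pq uq qb pb ti] _]]]]] := extremal_path_exists twb fpos ef lG0.
exact: (class_size GT uq qb pb).
Qed.

Variables (C : rel 'I_n) (lC : R).
Hypotheses (CT : in_class_T k C) (Ccomet : comet k C) (fC : first_dirichlet_eigenvalue C lC).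

(** An arbitrary comet [C] is allowed, so that [C] can be the given graph in one direction of the
    theorem and the standard comet in the other. *)
Lemma comet_extremal : lC <= lG /\ (lG <= lC -> comet k G).
Proof.
have twb := proj1 GT; have [f [f0 fpos ef]] := first_eigenfun_pos twb fG.
have fN0 : exists x, f x != 0.
  by have [_ _ _ /set0Pn[x /fpos xi]] := twb; exists x; rewrite lt0r_neq0.
have lG0 := pos_eigenvalue twb f0 ef fN0.
have [q [x [t [p [[pq uq qb pb ti] [xmin tmax t0]]]]]] := extremal_path_exists twb fpos ef lG0.
split; first exact: (comet_eigenvalue_le k1 GT f0 fpos ef pq uq qb pb ti xmin tmax CT Ccomet fC).
(* The equality case needs a second interior vertex on the path, hence the separate treatment of
   [k = 1]. *)
move=> le; have [E|k2] : (k = 1 \/ 2 <= k)%N by lia.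
  exact: comet_of_single_interior.
apply: (comet_eigenvalue_eq k1 GT f0 fpos ef pq uq qb pb ti xmin tmax CT Ccomet fC) => //.
by apply: t0; rewrite (proj2 GT).
Qed.

End Extremality.

Theorem theorem1 (R : realType) (n k : nat) (hk1 : (1 <= k)%N) (hkn : (k <= n.-1)%N) :
  (forall G : rel 'I_n, in_class_T k G -> (faber_krahn R k G <-> comet k G)) /\
  (forall G H : rel 'I_n, in_class_T k G -> in_class_T k H ->
     comet k G -> comet k H -> graph_iso G H).
Proof.
split=> [G GT|G H GT HT Gc Hc]; last first.
  have [w lw] := comet_labelling hk1 GT Gc; have [w' lw'] := comet_labelling hk1 HT Hc.
  exact: comet_label_iso lw lw'.
split=> [FK|Gc H HT lG lH fG fH]; last by have [] := comet_extremal hk1 HT fH GT Gc fG.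
have [_ _ _ iG] := proj1 GT.
have [lG fG] := first_dirichlet_exists R (twb_sym (proj1 GT)) iG.
have kn := class_nonempty_size GT fG.
(* The standard comet is the competitor: the Faber-Krahn property gives [lG <= lC], which is the
   equality case. *)
have CT := std_in_class hk1 kn; have Cc := std_is_comet hk1 kn.
have [_ _ _ iC] := proj1 CT.
have [lC fC] := first_dirichlet_exists R (twb_sym (proj1 CT)) iC.
by have [_] := comet_extremal hk1 GT fG CT Cc fC; apply; apply: FK fG fC.
Qed.
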